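(* Let $H$ be a semisimple Hopf algebra over $\mathbb C$ with $\dim_{\mathbb C}H=N$ finite. Then $H$ has at most $2^{N-1}$ left coideal subalgebras.
   Context: A left coideal subalgebra of $H$ is a unital subalgebra $K\subseteq H$ satisfying $\delta_H(K)\subseteq H\otimes K$, where $\delta_H$ is the comultiplication of $H$. *)

(* Defs.v *)
From HB Require Import structures.
From mathcomp Require Import all_boot all_order all_algebra all_field.
From mathcomp Require Import all_classical all_reals.
From mathcomp Require Import complex.

Set Implicit Arguments.
Unset Strict Implicit.
Unset Printing Implicit Defensive.

Import GRing.Theory.

Local Open Scope ring_scope.

(* A model of U (x) V: the matrix M stands for \sum_(i, j) M i j *: (e_i (x) f_j)
   where e = vbasis {:U} and f = vbasis {:V}. It is characterized by the
   universal property tlift_tens / tens_ext below. In particular the matrix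
   product plays no role here. *)
Definition tensor (F : fieldType) (U V : vectType F) : Type :=
  'M[F]_(\dim {:U}, \dim {:V}).

HB.instance Definition _ (F : fieldType) (U V : vectType F) :=
  Vector.copy (tensor U V) 'M[F]_(\dim {:U}, \dim {:V}).

Definition tens (F : fieldType) (U V : vectType F) (u : U) (v : V) :
    tensor U V :=
  \matrix_(i, j) (coord (vbasis {:U}) i u * coord (vbasis {:V}) j v).

(* The linear map on U (x) V induced by b; meaningful when b is bilinear. *)
Definition tlift (F : fieldType) (U V W : vectType F) (b : U -> V -> W)
    (t : tensor U V) : W :=
  \sum_i \sum_j t i j *: b (vbasis {:U})`_i (vbasis {:V})`_j.

Fact tlift_is_linear (F : fieldType) (U V W : vectType F) (b : U -> V -> W) :
  linear (tlift b).
Proof.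
move=> a s t; rewrite /tlift scaler_sumr -big_split; apply: eq_bigr => i _ /=.
rewrite scaler_sumr -big_split; apply: eq_bigr => j _ /=.
by rewrite !mxE scalerDl scalerA.
Qed.

HB.instance Definition _ (F : fieldType) (U V W : vectType F)
    (b : U -> V -> W) :=
  GRing.isLinear.Build F (tensor U V) W _ (tlift b) (tlift_is_linear b).

Lemma tlift_tens (F : fieldType) (U V W : vectType F) (b : U -> V -> W) :
    (forall v, linear (b^~ v)) -> (forall u, linear (b u)) ->
  forall u v, tlift b (tens u v) = b u v.
Proof.
move=> bl br u v.
pose bl' w := GRing.isLinear.Build F U W _ (b^~ w) (bl w).
pose br' w := GRing.isLinear.Build F V W _ (b w) (br w).
pose L w : {linear U -> W} := HB.pack (b^~ w) (bl' w).
pose M w : {linear V -> W} := HB.pack (b w) (br' w).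
rewrite {2}(coord_vbasis (memvf u)) -[RHS]/(L v _) linear_sum /=.
apply: eq_bigr => i _; rewrite -[RHS]/(L v _) linearZ /=.
rewrite {2}(coord_vbasis (memvf v)) -[b _ (\sum_(_ < _) _)]/(M _ _) linear_sum.
rewrite scaler_sumr; apply: eq_bigr => j _.
by rewrite linearZ /= mxE scalerA.
Qed.

Lemma tens_ext (F : fieldType) (U V W : vectType F)
    (f g : {linear tensor U V -> W}) :
  (forall u v, f (tens u v) = g (tens u v)) -> f =1 g.
Proof.
move=> fg t.
have -> : t = \sum_i \sum_j
    t i j *: tens (vbasis {:U})`_i (vbasis {:V})`_j.
  apply/matrixP => k l; rewrite summxE (bigD1 k) //= summxE (bigD1 l) //=.
  have fU := basis_free (vbasisP {:U}); have fV := basis_free (vbasisP {:V}).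
  rewrite !mxE !coord_free // !eqxx !mulr1 !big1 ?addr0 // => i ni.
    rewrite summxE big1 // => j _.
    by rewrite !mxE !coord_free // (negPf ni) mul0r mulr0.
  by rewrite !mxE !coord_free // (negPf ni) !mulr0.
rewrite !linear_sum; apply: eq_bigr => i _; rewrite !linear_sum.
by apply: eq_bigr => j _; rewrite !linearZ fg.
Qed.

Definition tmap (F : fieldType) (U V U' V' : vectType F)
    (f : U -> U') (g : V -> V') : tensor U V -> tensor U' V' :=
  tlift (fun u v => tens (f u) (g v)).

Definition tassoc (F : fieldType) (U V W : vectType F) :
    tensor (tensor U V) W -> tensor U (tensor V W) :=
  tlift (fun t w => tlift (fun u v => tens u (tens v w)) t).

(* The product of A (x) A: (a (x) b) * (c (x) d) = (a * c) (x) (b * d). *)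
Definition tmul (F : fieldType) (A : falgType F) (s t : tensor A A) :
    tensor A A :=
  tlift (fun a b => tlift (fun c d => tens (a * c) (b * d)) t) s.

(* The image of X (x) Y in U (x) V. *)
Definition tensorv (F : fieldType) (U V : vectType F)
    (X : {vspace U}) (Y : {vspace V}) : {vspace tensor U V} :=
  <<[seq tens x y | x <- vbasis X, y <- vbasis Y]>>%VS.

HB.mixin Record isHopf (F : fieldType) (H : Type) of Falgebra F H := {
  comul : {linear H -> tensor H H};
  counit : {scalar H};
  antipode : {linear H -> H};
  comul1 : comul 1 = tens 1 1;
  comulM : forall x y : H, comul (x * y) = tmul (comul x) (comul y);
  counit1 : counit 1 = 1;
  counitM : forall x y : H, counit (x * y) = counit x * counit y;
  comulA : forall x : H,
    tassoc (tmap comul idfun (comul x)) = tmap idfun comul (comul x);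
  counitl : forall x : H, tlift (fun a b : H => counit a *: b) (comul x) = x;
  counitr : forall x : H, tlift (fun a b : H => counit b *: a) (comul x) = x;
  antipodel : forall x : H,
    tlift (fun a b : H => antipode a * b) (comul x) = (counit x)%:A;
  antipoder : forall x : H,
    tlift (fun a b : H => a * antipode b) (comul x) = (counit x)%:A
}.

(* Finite-dimensional Hopf algebras, finite dimension being part of falgType. *)
#[short(type="hopfType")]
HB.structure Definition Hopf (F : fieldType) :=
  { H of isHopf F H & Falgebra F H }.

Definition left_ideal (F : fieldType) (A : falgType F) (I : {vspace A}) : Prop :=
  ({:A} * I <= I)%VS.

Definition minimal_left_ideal (F : fieldType) (A : falgType F)
    (I : {vspace A}) : Prop :=
  [/\ left_ideal I, I <> 0%VS &
      forall J : {vspace A}, left_ideal J -> (J <= I)%VS -> J = 0%VS \/ J = I].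

(* The left regular module is a direct sum of simple submodules. *)
Definition semisimple (F : fieldType) (A : falgType F) : Prop :=
  exists (n : nat) (I : 'I_n -> {vspace A}),
    [/\ forall i, minimal_left_ideal (I i), directv (\sum_(i < n) I i) &
        (\sum_(i < n) I i)%VS = {:A}%VS].

Definition left_coideal_subalgebra (F : fieldType) (H : hopfType F)
    (K : {vspace H}) : Prop :=
  [/\ 1 \in K, (K * K <= K)%VS &
      forall x, x \in K -> comul x \in tensorv {:H} K].

(* Main.v *)
Require Import Defs.
From HB Require Import structures.
From mathcomp Require Import all_boot all_order all_algebra all_field.
From mathcomp Require Import all_classical all_reals.
From mathcomp Require Import complex.
From mathcomp Require Import ring zify.

(** A left coideal subalgebra K of a semisimple complex Hopf algebra H is
    encoded by one element L of K, and these elements are nondegenerate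
    solutions of a system of quadratic equations in N - 1 unknowns.  Such a
    system has at most 2 ^ (N - 1) nondegenerate solutions.

    Larson-Radford.  Let chi be the character of the left regular
    representation of H.  Then x_1 chi(x_2) = chi(x) 1, so that chi is both a
    trace and an integral ([regchar_integral]).  A semisimple H has a two-sided
    integral T with eps(T) = 1, and Delta(T) is nondegenerate, which gives an
    integral rho on H, with Nakayama automorphism S^2.  The density omega of chi
    with respect to rho implements S^2 by conjugation; Radford's formula makes
    S^4 the conjugation by a grouplike element, which has finite order.  Hence
    some power of omega is central, and a positivity argument on the blocks of
    H, the only place where complex conjugation enters, shows that
    tr(S^2) = rho(1) is positive ([rho1_gt0]).  This forces S^4 = 1.  As
    chi / N is an idempotent for convolution, tr(S^2) is moreover N times an
    integer, hence N, so S^2 = 1 and chi = rho.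

    The element attached to K.  The kernel of the form chi(xy) on K is a left
    coideal all of whose elements are nilpotent; a nonzero left coideal contains
    an element of nonzero counit, so the form is nondegenerate on K.  It yields
    L in K with k L = eps(k) L = L k for k in K, eps(L) = 1 and chi(L) != 0
    ([coideal_integral]).  The identity L_1 chi(y L_2) = chi(L) S(y) for y in K
    recovers K from L.

    The equations.  Since L_2 lies in K, L_1 (x) L_2 L = L (x) L: this is a
    system of homogeneous quadrics, considered on the affine hyperplane eps = 1
    of dimension N - 1.  Pairing its linearization at L with chi(y -), for y = 1
    and y = L, shows that the tangent space is zero ([biproj_form_nondeg]).

    Counting.  A weak form of the Bezout bound is proved algebraically
    ([nondegenerate_quadric_points]).  Generic combinations reduce to n
    equations f_c = 0 in n unknowns, and each nondegenerate zero lifts, modulo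
    any power of t, to a zero of t x_c^2 + f_c.  By these relations, t times a
    monomial with a repeated variable is a combination of monomials, whence
    (t - A) E = B E' modulo t^k, where E and E' hold the values of all monomials
    of a given degree and of the 2 ^ n squarefree ones at the lifted points, and
    A is a constant matrix.  As det(t - A) is a nonzero polynomial and some
    combinations of the monomials separate the points, more than 2 ^ n points
    would give a square matrix of rank at most 2 ^ n, and of larger size, with a
    nonzero determinant. *)

Set Implicit Arguments.
Unset Strict Implicit.
Unset Printing Implicit Defensive.

Import GRing.Theory Num.Theory Order.TTheory.

Local Open Scope ring_scope.

(** * Linear maps given by expressions *)

(** A predicate on bare functions, because the maps to which it is applied
    are anonymous expressions in Sweedler components, for which no bundled
    linear structure can be inferred. *)
Definition lin (F : fieldType) (V W : lmodType F) (f : V -> W) : Prop :=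
  forall (a : F) (x y : V), f (a *: x + y) = a *: f x + f y.

(** Scalar-valued functions are linear as maps to the regular module; naming
    it lets them keep F as codomain. *)
Notation linF f := (@lin _ _ (_^o) f).

Section Lin.
Variables (F : fieldType).
Implicit Types (U V W : lmodType F).

Lemma linE V W (f : V -> W) : lin f -> linear f.
Proof. by move=> lf a x y; apply: lf. Qed.

Lemma lin_linear V W (f : {linear V -> W}) : lin f.
Proof. by move=> a x y; rewrite linearP. Qed.

Lemma lin0 V W (f : V -> W) : lin f -> f 0 = 0.
Proof. by move=> lf; have := lf (-1) 0 0; rewrite scaler0 add0r scaleN1r addNr. Qed.

Lemma linZ V W (f : V -> W) : lin f -> forall a x, f (a *: x) = a *: f x.
Proof. by move=> lf a x; have := lf a x 0; rewrite !addr0 (lin0 lf) addr0. Qed.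

Lemma linD V W (f : V -> W) : lin f -> forall x y, f (x + y) = f x + f y.
Proof. by move=> lf x y; have := lf 1 x y; rewrite !scale1r. Qed.

Lemma lin_sum V W (f : V -> W) : lin f ->
  forall I (r : seq I) (P : pred I) E,
  f (\sum_(i <- r | P i) E i) = \sum_(i <- r | P i) f (E i).
Proof. by move=> lf I r P E; apply: big_morph; [exact: linD | exact: lin0]. Qed.

Lemma lin_id V : lin (fun x : V => x).
Proof. by []. Qed.

Lemma lin_comp U V W (f : V -> W) (g : U -> V) :
  lin f -> lin g -> lin (fun x => f (g x)).
Proof. by move=> lf lg a x y; rewrite lg lf. Qed.

Lemma lin_compl U V W (f : {linear V -> W}) (g : U -> V) :
  lin g -> lin (fun x => f (g x)).
Proof. exact: lin_comp (lin_linear f). Qed.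

Lemma lin_scaler V W (k : F) (f : V -> W) : lin f -> lin (fun x => k *: f x).
Proof. by move=> lf a x y; rewrite lf scalerDr !scalerA mulrC. Qed.

Lemma lin_scalel V W (f : V -> F) (w : W) : linF f -> lin (fun x => f x *: w).
Proof. by move=> lf a x y; rewrite lf scalerDl -scalerA. Qed.

Lemma lin_opp V W (f : V -> W) : lin f -> lin (fun x => - f x).
Proof. by move=> lf a x y; rewrite lf opprD scalerN. Qed.

Lemma lin_add V W (f g : V -> W) : lin f -> lin g -> lin (fun x => f x + g x).
Proof. by move=> lf lg a x y; rewrite lf lg scalerDr addrACA. Qed.

Lemma lin_bigsum V W I (r : seq I) (P : pred I) (f : I -> V -> W) :
  (forall i, lin (f i)) -> lin (fun x => \sum_(i <- r | P i) f i x).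
Proof.
move=> lf a x y; rewrite scaler_sumr -big_split; apply: eq_bigr => i _.
exact: lf.
Qed.

Lemma lin_mull V (A : algType F) (f : V -> A) (c : A) :
  lin f -> lin (fun x => f x * c).
Proof. by move=> lf a x y; rewrite lf mulrDl scalerAl. Qed.

Lemma lin_mulr V (A : algType F) (f : V -> A) (c : A) :
  lin f -> lin (fun x => c * f x).
Proof. by move=> lf a x y; rewrite lf mulrDr scalerAr. Qed.

Lemma lin_mulFl V (f : V -> F) (c : F) : linF f -> linF (fun x => f x * c).
Proof. by move=> lf a x y; rewrite lf mulrDl -[a *: (f x : F^o)]/(a * f x) -mulrA. Qed.

Lemma lin_mulFr V (f : V -> F) (c : F) : linF f -> linF (fun x => c * f x).
Proof. by move=> lf a x y; rewrite lf mulrDr -[a *: (f x : F^o)]/(a * f x) mulrCA. Qed.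

End Lin.

(** * Sweedler notation *)

Section Sweedler.
Variables (F : fieldType) (H : hopfType F).
Local Notation e := (vbasis {:H}).

(** Sweedler's b(x_1, x_2), for a bilinear b. *)
Definition sw (W : lmodType F) (b : H -> H -> W) (x : H) : W :=
  \sum_i \sum_j comul x i j *: b e`_i e`_j.

Lemma eq_sw (W : lmodType F) (b b' : H -> H -> W) x :
  (forall a c, b a c = b' a c) -> sw b x = sw b' x.
Proof. by move=> bb'; apply: eq_bigr => i _; apply: eq_bigr => j _; rewrite bb'. Qed.

Lemma lin_sw (W : lmodType F) (b : H -> H -> W) : lin (sw b).
Proof.
move=> a x y; rewrite /sw linearP scaler_sumr -big_split; apply: eq_bigr => i _ /=.
rewrite scaler_sumr -big_split; apply: eq_bigr => j _ /=.
by rewrite !mxE scalerDl scalerA.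
Qed.

Lemma lin_sw_comp (V W : lmodType F) (b : H -> H -> W) (g : V -> H) :
  lin g -> lin (fun x => sw b (g x)).
Proof. exact: lin_comp (lin_sw b). Qed.

Lemma lin_sw_in (V W : lmodType F) (b : V -> H -> H -> W) (h : H) :
  (forall a c, lin (fun x => b x a c)) -> lin (fun x => sw (b x) h).
Proof.
by move=> lb; do 2!apply: lin_bigsum => ?; apply: lin_scaler.
Qed.

Lemma lin_tensl (V : lmodType F) (U1 U2 : vectType F) (f : V -> U1) (u : U2) :
  lin f -> lin (fun x => tens (f x) u).
Proof.
move=> lf a x y; apply/matrixP => i j; rewrite !mxE lf linearP /=.
by rewrite mulrDl mulrA.
Qed.

Lemma lin_tensr (V : lmodType F) (U1 U2 : vectType F) (f : V -> U2) (u : U1) :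
  lin f -> lin (fun x => tens u (f x)).
Proof.
move=> lf a x y; apply/matrixP => i j; rewrite !mxE lf linearP /=.
by rewrite mulrDr mulrCA.
Qed.

Lemma lin_counit (V : lmodType F) (f : V -> H) :
  lin f -> linF (fun x => counit (f x)).
Proof. by move=> lf a x y; rewrite lf linearP. Qed.

End Sweedler.

(** The laws of Sweedler notation hold for multilinear maps only, so each use
    leaves linearity conditions on explicit expressions; this tactic follows the
    syntax of the expression. *)
Ltac lint :=
  intros; cbv beta;
  first
  [ assumption
  | exact: lin_id
  | apply: lin_add; [lint | lint]
  | apply: lin_opp; lint
  | apply: lin_scaler; lint
  | apply: lin_scalel; lint
  | apply: lin_mull; lint
  | apply: lin_mulr; lint
  | apply: lin_mulFl; lint
  | apply: lin_mulFr; lint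
  | apply: lin_counit; lint
  | apply: lin_tensl; lint
  | apply: lin_tensr; lint
  | apply: lin_sw_comp; lint
  | apply: lin_sw_in; lint
  | apply: lin_compl; lint
  | match goal with Hb : forall c, lin _ |- _ => exact: Hb end
  | match goal with
    | Hf : @lin ?F0 ?V0 ?W0 ?f |- @lin _ ?U0 _ (fun x => ?f (@?g x)) =>
        apply: (@lin_comp F0 U0 V0 W0 f g Hf); lint
    | Hb : forall c, @lin ?F0 ?V0 ?W0 (fun x => ?b x c)
      |- @lin _ ?U0 _ (fun x => ?b (@?g x) ?d) =>
        apply: (@lin_comp F0 U0 V0 W0 (fun y => b y d) g (Hb d)); lint
    | Hb : forall c, @lin ?F0 ?V0 ?W0 (?b c)
      |- @lin _ ?U0 _ (fun x => ?b ?d (@?g x)) =>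
        apply: (@lin_comp F0 U0 V0 W0 (b d) g (Hb d)); lint
    end
  ].

Section TensorLift.
Variables (F : fieldType) (U V : vectType F) (W : lmodType F).

(** The map tlift for a target that is any module, so that the laws below do
    not depend on the target of the multilinear expression. *)
Definition mlift (b : U -> V -> W) (s : tensor U V) : W :=
  \sum_i \sum_j s i j *: b (vbasis {:U})`_i (vbasis {:V})`_j.

Lemma lin_mlift b : lin (mlift b).
Proof.
move=> a x y; rewrite /mlift scaler_sumr -big_split; apply: eq_bigr => i _ /=.
rewrite scaler_sumr -big_split; apply: eq_bigr => j _ /=.
by rewrite !mxE scalerDl scalerA.
Qed.

Lemma mlift_tens (b : U -> V -> W) :
    (forall v, lin (fun u => b u v)) -> (forall u, lin (b u)) ->
  forall u v, mlift b (tens u v) = b u v.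
Proof.
move=> bl br u v.
rewrite [in RHS](coord_vbasis (memvf u)) [in RHS](coord_vbasis (memvf v)).
rewrite (lin_sum (bl _)); apply: eq_bigr => i _.
rewrite (lin_sum (br _)); apply: eq_bigr => j _.
by rewrite (linZ (br _)) (linZ (bl _)) mxE scalerA mulrC.
Qed.

Lemma lin_tlift (Z : vectType F) (f : Z -> W) (b : U -> V -> Z) s :
  lin f -> f (tlift b s) = mlift (fun u v => f (b u v)) s.
Proof.
move=> lf; rewrite /tlift (lin_sum lf); apply: eq_bigr => i _.
by rewrite (lin_sum lf); apply: eq_bigr => j _; rewrite (linZ lf).
Qed.

End TensorLift.

Lemma eq_mlift (F : fieldType) (U V : vectType F) (W : lmodType F)
    (b b' : U -> V -> W) s :
  (forall u v, b u v = b' u v) -> mlift b s = mlift b' s.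
Proof. by move=> bb'; apply: eq_bigr => i _; apply: eq_bigr => j _; rewrite bb'. Qed.

Lemma lin_mlift_in (F : fieldType) (U V : vectType F) (W Z : lmodType F)
    (b : Z -> U -> V -> W) s :
  (forall u v, lin (fun x => b x u v)) -> lin (fun x => mlift (b x) s).
Proof. by move=> lb; do 2!apply: lin_bigsum => ?; apply: lin_scaler. Qed.

Section SweedlerLaws.
Variables (F : fieldType) (H : hopfType F).
Variable (W : lmodType F).
Implicit Types (b : H -> H -> W) (x y : H).

Lemma sw_lin (Z : lmodType F) (f : W -> Z) b x :
  lin f -> f (sw b x) = sw (fun a c => f (b a c)) x.
Proof.
move=> lf; rewrite /sw (lin_sum lf); apply: eq_bigr => i _.
by rewrite (lin_sum lf); apply: eq_bigr => j _; rewrite (linZ lf).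
Qed.

Lemma sw_sum I (r : seq I) (b : I -> H -> H -> W) x :
  sw (fun u v => \sum_(i <- r) b i u v) x = \sum_(i <- r) sw (b i) x.
Proof.
rewrite /sw [RHS]exchange_big; apply: eq_bigr => k _ /=.
rewrite [RHS]exchange_big; apply: eq_bigr => l _ /=.
by rewrite scaler_sumr.
Qed.

Lemma sw_exch (t : H -> H -> H -> H -> W) x y :
  sw (fun a c => sw (fun u v => t a c u v) y) x =
  sw (fun u v => sw (fun a c => t a c u v) x) y.
Proof.
have swc r b : sw (fun u v => r *: b u v) y = r *: sw b y.
  by rewrite -(@sw_lin _ ( *:%R r)) //; exact: lin_scaler.
rewrite {1 4}/sw sw_sum; apply: eq_bigr => i _; rewrite sw_sum.
by apply: eq_bigr => j _; rewrite swc.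
Qed.

(** The two sides are the images of the two iterated coproducts of x under the
    linear map induced by t. *)
Lemma swA (t : H -> H -> H -> W) x :
    (forall v w, lin (fun u => t u v w)) -> (forall u w, lin (fun v => t u v w)) ->
    (forall u v, lin (t u v)) ->
  sw (fun a c => sw (fun u v => t u v c) a) x =
  sw (fun a c => sw (fun u v => t a u v) c) x.
Proof.
move=> t1 t2 t3.
pose Psi := mlift (fun u s => mlift (t u) s).
have lPsi : lin Psi by exact: lin_mlift.
have PsiE u v w : Psi (tens u (tens v w)) = t u v w.
  rewrite /Psi mlift_tens ?mlift_tens // => [s|u']; last exact: lin_mlift.
  by apply: lin_mlift_in => ? ?; exact: t1.
have := congr1 Psi (comulA x).
have -> : Psi (tmap idfun comul (comul x)) =
          sw (fun a c => sw (fun u v => t a u v) c) x.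
  rewrite /tmap (lin_tlift _ _ lPsi); apply: eq_sw => a c.
  rewrite /Psi mlift_tens // => [s|u']; last exact: lin_mlift.
  by apply: lin_mlift_in => ? ?; exact: t1.
move=> <-; rewrite /tmap.
have lPa : lin (fun s => Psi (tassoc s)).
  exact: (lin_comp lPsi (lin_linear (tlift _))).
rewrite (lin_tlift _ _ lPa); apply: eq_sw => a c.
rewrite /tassoc tlift_tens.
- rewrite (lin_tlift _ _ lPsi); apply: eq_sw => u v; symmetry; exact: PsiE.
- by move=> w r s1 s2 /=; rewrite linearP.
- move=> s r w1 w2 /=; rewrite scaler_sumr -big_split; apply: eq_bigr => i _ /=.
  rewrite scaler_sumr -big_split; apply: eq_bigr => j _ /=.
  rewrite (lin_tensr _ (lin_tensr _ (@lin_id _ H))) scalerDr !scalerA.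
  by rewrite mulrC.
Qed.

Lemma sw1 b : (forall v, lin (fun u => b u v)) -> (forall u, lin (b u)) ->
  sw b 1 = b 1 1.
Proof. by move=> b1 b2; rewrite -(mlift_tens b1 b2) -comul1. Qed.

Lemma swM b x y : (forall v, lin (fun u => b u v)) -> (forall u, lin (b u)) ->
  sw b (x * y) = sw (fun a c => sw (fun u v => b (a * u) (c * v)) y) x.
Proof.
move=> b1 b2; rewrite -[LHS]/(mlift b _) comulM /tmul (lin_tlift _ _ (lin_mlift b)).
apply: eq_sw => a c; rewrite (lin_tlift _ _ (lin_mlift b)).
by apply: eq_sw => u v; rewrite mlift_tens.
Qed.

Lemma sw_eps_l (f : H -> W) x : lin f -> sw (fun a c => counit a *: f c) x = f x.
Proof.
move=> lf; rewrite -{2}(counitl x) (lin_tlift _ _ lf).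
by apply: eq_sw => a c; rewrite (linZ lf).
Qed.

Lemma sw_eps_r (f : H -> W) x : lin f -> sw (fun a c => counit c *: f a) x = f x.
Proof.
move=> lf; rewrite -{2}(counitr x) (lin_tlift _ _ lf).
by apply: eq_sw => a c; rewrite (linZ lf).
Qed.

Lemma sw_Sl (f : H -> W) x : lin f ->
  sw (fun a c => f (antipode a * c)) x = counit x *: f 1.
Proof. by move=> lf; rewrite -(linZ lf) -antipodel (lin_tlift _ _ lf). Qed.

Lemma sw_Sr (f : H -> W) x : lin f ->
  sw (fun a c => f (a * antipode c)) x = counit x *: f 1.
Proof. by move=> lf; rewrite -(linZ lf) -antipoder (lin_tlift _ _ lf). Qed.

End SweedlerLaws.

(** * The antipode is an anti-morphism of algebras and of coalgebras *)

Section Antipode.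
Variables (F : fieldType) (H : hopfType F).
Implicit Types (x y : H).
Local Notation S := (@antipode F H).
Local Notation eps := (@counit F H).

(** For the convolution product on Hom(H (x) H, H), the maps S(xy) and
    S(y)S(x) are a left and a right inverse of the multiplication, so they are
    equal.  Both groupings of S(x_1 y_1) x_2 y_2 S(y_3) S(x_3) are computed. *)
Lemma antipodeM x y : S (x * y) = S y * S x.
Proof.
pose Z (u v : H) : H := sw (fun a b => sw (fun c d => a * c * (S d * S b)) v) u.
have ZE u v : Z u v = (eps u * eps v)%:A.
  rewrite /Z.
  transitivity (sw (fun a b => eps v *: (a * S b)) u).
    apply: eq_sw => a b.
    have := @sw_Sr F H H (fun z => a * z * S b) v ltac:(lint).
    by rewrite mulr1 => <-; apply: eq_sw => c d; rewrite !mulrA.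
  by rewrite (@sw_Sr F H H (fun z => eps v *: z) u ltac:(lint)) scalerA.
transitivity (sw (fun x1 x2 => sw (fun y1 y2 => S (x1 * y1) * Z x2 y2) y) x).
  transitivity (sw (fun x1 x2 => eps x2 *: S (x1 * y)) x).
    by rewrite sw_eps_r //; lint.
  apply: eq_sw => x1 x2.
  have := @sw_eps_r F H H (fun z => eps x2 *: S (x1 * z)) y ltac:(lint).
  move=> <-; apply: eq_sw => y1 y2.
  by rewrite ZE -scalerAr mulr1 scalerA mulrC.
(* Regroup, with x1, a, b and y1, c, d the three components of x and of y. *)
pose t x1 a b y1 c d : H := S (x1 * y1) * (a * c * (S d * S b)).
transitivity (sw (fun x1 x2 => sw (fun a b =>
   sw (fun y1 y2 => sw (fun c d => t x1 a b y1 c d) y2) y) x2) x).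
  apply: eq_sw => x1 x2; rewrite -sw_exch; apply: eq_sw => y1 y2.
  rewrite /Z (@sw_lin F H H H (fun z => S (x1 * y1) * z)); last by lint.
  apply: eq_sw => a b; apply: sw_lin; lint.
rewrite -(@swA F H H (fun x1 a b =>
   sw (fun y1 y2 => sw (fun c d => t x1 a b y1 c d) y2) y));
  try by rewrite /t; lint.
transitivity (sw (fun p b => sw (fun q d => eps p * eps q *: (S d * S b)) y) x).
  apply: eq_sw => p b.
  transitivity (sw (fun q d => sw (fun x1 a => sw (fun y1 c => t x1 a b y1 c d) q) p) y).
    rewrite [RHS]sw_exch; apply: eq_sw => x1 a.
    by symmetry; apply: (@swA F H H (fun y1 c d => t x1 a b y1 c d)); rewrite /t; lint.
  apply: eq_sw => q d.
  have := @sw_Sl F H H (fun z => z * (S d * S b)) (p * q) ltac:(lint).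
  rewrite mul1r counitM => <-.
  rewrite swM; try lint.
  by apply: eq_sw => x1 a; apply: eq_sw => y1 c; rewrite /t !mulrA.
transitivity (sw (fun p b => eps p *: (S y * S b)) x).
  apply: eq_sw => p b.
  rewrite -(@sw_eps_l F H H (fun z => eps p *: (S z * S b)) y); last by lint.
  by apply: eq_sw => q d; rewrite scalerA mulrC.
by rewrite sw_eps_l //; lint.
Qed.

Lemma antipode1 : S 1 = 1.
Proof.
have := @sw_Sl F H H id 1 ltac:(lint).
rewrite sw1; try lint.
by rewrite counit1 scale1r mulr1.
Qed.

Lemma counit_antipode x : eps (S x) = eps x.
Proof.
transitivity (@sw F H F^o (fun a b => eps (S a * b)) x : F).
  rewrite -(@sw_eps_r F H F^o (fun z => eps (S z)) x); last by lint.
  by apply: (@eq_sw F H F^o) => a b; rewrite counitM mulrC.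
rewrite (@sw_Sl F H F^o eps x); last exact: (lin_counit (@lin_id F H)).
by rewrite counit1 -[_ *: _]/(_ * _) mulr1.
Qed.

(** The same argument in Hom(H, H (x) H): Delta(S x) and S(x_2) (x) S(x_1) are
    a left and a right convolution inverse of Delta. *)
Lemma comul_antipode (W : lmodType F) (b : H -> H -> W) x :
    (forall v, lin (fun u => b u v)) -> (forall u, lin (b u)) ->
  sw b (S x) = sw (fun a c => b (S c) (S a)) x.
Proof.
move=> b1 b2.
pose t p q u v s r := b (p * u * S r) (q * v * S s).
pose Y p q z := sw (fun z1 z2 => sw (fun u v => sw (t p q u v) z2) z1) z.
have YE p q z : Y p q z = eps z *: b p q.
  rewrite /Y (@swA F H W (fun u v z2 => sw (t p q u v) z2)); try by rewrite /t; lint.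
  transitivity (sw (fun u r => b (p * (u * S r)) q) z); last first.
    have := @sw_Sr F H W (fun w => b (p * w) q) z ltac:(lint).
    by rewrite mulr1.
  apply: eq_sw => u r.
  rewrite -(@swA F H W (fun v s r => t p q u v s r)); try by rewrite /t; lint.
  rewrite -(@sw_eps_l F H W (fun r => b (p * (u * S r)) q)); last by lint.
  apply: eq_sw => w r'.
  have := @sw_Sr F H W (fun w => b (p * (u * S r')) (q * w)) w ltac:(lint).
  by rewrite mulr1 => <-; apply: eq_sw => v s; rewrite /t !mulrA.
transitivity (sw (fun x1 x2 => sw (fun p q => Y p q x2) (S x1)) x).
  rewrite -(@sw_eps_r F H W (fun z => sw b (S z))); last by lint.
  apply: eq_sw => x1 x2.
  rewrite (@sw_lin F H W W (fun z => eps x2 *: z)); last by lint.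
  by apply: eq_sw => p q; rewrite YE.
pose G x1 z1 z2 := sw (fun p q => sw (fun u v => sw (t p q u v) z2) z1) (S x1).
transitivity (sw (fun x1 x2 => sw (G x1) x2) x).
  by apply: eq_sw => x1 x2; rewrite /Y sw_exch.
rewrite -(@swA F H W G); try by rewrite /G /t; lint.
pose B z2 p q := sw (fun s r => b (p * S r) (q * S s)) z2.
have GE x1 z1 z2 : G x1 z1 z2 = sw (B z2) (S x1 * z1).
  by rewrite swM //; rewrite /B; lint.
transitivity (sw (fun y z2 => eps y *: B z2 1 1) x).
  apply: eq_sw => y z2.
  have := @sw_Sl F H W (fun w => sw (B z2) w) y ltac:(lint).
  rewrite sw1; [ move=> <- | by rewrite /B; lint | by rewrite /B; lint].
  by apply: eq_sw => x1 z1; rewrite GE.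
rewrite (@sw_eps_l F H W (fun z2 => B z2 1 1)); last by rewrite /B; lint.
by apply: eq_sw => s r; rewrite !mul1r.
Qed.

End Antipode.

(** * Integrals in a semisimple Hopf algebra *)

Section SemisimpleIntegral.
Variables (F : fieldType) (H : hopfType F).
Local Notation eps := (@counit F H).

(** The left ideal Ker eps is proper, so some simple summand I of H is not
    contained in it.  Then I meets Ker eps in 0, hence h acts on I as the scalar eps(h). *)
Lemma semisimple_integral : semisimple H ->
  exists2 T : H, (forall x, x * T = eps x *: T) & eps T = 1.
Proof.
case=> n [I [minI _ sumI]].
pose K := lker (linfun (eps : H -> F^o)).
have inK x : (x \in K) = (eps x == 0) by rewrite memv_ker lfunE.
have [i nIK] : exists i, ~~ (I i <= K)%VS.
  apply/existsP; apply: contraT; rewrite negb_exists => /forallP IK.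
  have : (1 : H) \in K.
    apply: (subvP _ _ (memvf 1)); rewrite -sumI; apply/subv_sumP => i _.
    by have := IK i; rewrite negbK.
  by rewrite inK counit1 oner_eq0.
have [lI _ Imin] := minI i.
have lJ : left_ideal (I i :&: K)%VS.
  apply/prodvP => x y _; rewrite !memv_cap => /andP[yI yK].
  rewrite (subvP lI) ?memv_mul ?memvf //=.
  by move: yK; rewrite !inK counitM => /eqP ->; rewrite mulr0.
have J0 : (I i :&: K)%VS = 0%VS.
  have [// | JI] := Imin _ lJ (capvSl _ _).
  by case/negP: nIK; rewrite -JI capvSr.
have /subvPn[v vI] := nIK; rewrite inK => nv.
exists ((eps v)^-1 *: v) => [x|]; last first.
  by rewrite linearZ /= mulVf.
rewrite -scalerAr scalerA mulrC -scalerA; congr (_ *: _).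
apply/eqP; rewrite -subr_eq0 -memv0 -J0 memv_cap inK.
have xvI : x * v \in I i by apply: (subvP lI); rewrite memv_mul ?memvf.
rewrite rpredB ?rpredZ //=.
by rewrite linearB /= linearZ /= counitM subrr.
Qed.

End SemisimpleIntegral.

Section Integral.
Variables (F : fieldType) (H : hopfType F).
Implicit Types (x y : H).
Local Notation S := (@antipode F H).
Local Notation eps := (@counit F H).
Local Notation e := (vbasis {:H}).
Local Notation Dm x := (comul x : 'M_(\dim {:H})).
Variable T : H.
Hypothesis Tl : forall x, x * T = eps x *: T.
Hypothesis epsT : eps T = 1.

Lemma lin_counit_id : linF eps.
Proof. exact: (lin_counit (@lin_id F H)). Qed.

Lemma lin_coord i : linF (coord e i : H -> F).
Proof. exact: lin_linear. Qed.

(** Holds because S(x_1) x_2 T_1 (x) x_3 T_2 can be simplified either by the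
    antipode law or by x_2 T = eps(x_2) T. *)
Lemma int_swapl (W : lmodType F) (b : H -> H -> W) x :
    (forall v, lin (fun u => b u v)) -> (forall u, lin (b u)) ->
  sw (fun a c => b (S x * a) c) T = sw (fun a c => b a (x * c)) T.
Proof.
move=> b1 b2.
transitivity (sw (fun x1 x2 => sw (fun a c => b (S x1 * a) c) (x2 * T)) x).
  rewrite -(@sw_eps_r F H W (fun z => sw (fun a c => b (S z * a) c) T)); last by lint.
  by apply: eq_sw => x1 x2; rewrite Tl (linZ (lin_sw _)).
pose t x1 y1 y2 := sw (fun a c => b (S x1 * (y1 * a)) (y2 * c)) T.
transitivity (sw (fun x1 x2 => sw (t x1) x2) x).
  by apply: eq_sw => x1 x2; rewrite swM //; lint.
rewrite -swA; try by rewrite /t; lint.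
rewrite -(@sw_eps_l F H W (fun z => sw (fun a c => b a (z * c)) T)); last by lint.
apply: eq_sw => y z.
have := @sw_Sl F H W (fun w => sw (fun a c => b (w * a) (z * c)) T) y ltac:(lint).
under [X in _ = _ *: X]eq_sw => a c do rewrite mul1r.
by move=> <-; apply: eq_sw => u v; apply: eq_sw => a c; rewrite mulrA.
Qed.

Lemma vec_coord x : x = \sum_i coord e i x *: e`_i.
Proof. exact: (coord_vbasis (memvf x)). Qed.

(** By [int_swapl] the elements f(T_1) T_2 form a left ideal; it contains
    S(T_1) T_2 = 1. *)
Lemma int_legl_surj y : exists2 f : H -> F, linF f & sw (fun a c => f a *: c) T = y.
Proof.
exists (fun a => \sum_i coord e i (S (y * S e`_i) * a)).
  apply: lin_bigsum => i; apply: (lin_comp (lin_coord i)); lint.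
transitivity (sw (fun a c => y * (S a * c)) T); last first.
  by rewrite (@sw_Sl F H H (fun z => y * z)); [rewrite epsT scale1r mulr1 | lint].
have lc i := lin_coord i.
transitivity (\sum_i sw (fun a c => coord e i (S (y * S e`_i) * a) *: c) T).
  by rewrite -sw_sum; apply: eq_sw => a c; rewrite scaler_suml.
transitivity (\sum_i sw (fun a c => coord e i a *: (y * S e`_i * c)) T).
  apply: eq_bigr => i _.
  rewrite (@int_swapl H (fun a c => coord e i a *: c) (y * S e`_i)) //; move=> *.
    by apply: lin_scalel.
  by lint.
rewrite -sw_sum; apply: eq_sw => a c.
rewrite [in RHS](vec_coord a) linear_sum /= mulr_suml mulr_sumr.
by apply: eq_bigr => i _; rewrite linearZ /= -scalerAl -scalerAr mulrA.
Qed.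

(** If S x = 0, then, by [int_swapl], x kills every f(T_1) T_2 on the left,
    hence kills 1. *)
Lemma antipode_inj : injective S.
Proof.
suff S0 x : S x = 0 -> x = 0.
  by move=> x y Sxy; apply/subr0_eq/S0; rewrite linearB /= Sxy subrr.
move=> Sx; have [f lf fT] := int_legl_surj 1.
rewrite -[x]mulr1 -fT (@sw_lin F H H H (fun z => x * z)); last by lint.
transitivity (sw (fun a c => f (S x * a) *: c) T).
  rewrite (@int_swapl H (fun a c => f a *: c) x); try by lint.
  by apply: eq_sw => a c; rewrite scalerAr.
rewrite Sx; transitivity (sw (fun _ _ => 0 : H) T).
  by apply: eq_sw => a c; rewrite mul0r (lin0 lf) scale0r.
by rewrite /sw big1 // => i _; rewrite big1 // => j _; rewrite scaler0.
Qed.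

Definition antipode_inv : H -> H := ((linfun S)^-1)%VF.
Local Notation Si := antipode_inv.

Lemma lin_antipode_inv : lin Si. Proof. exact: lin_linear. Qed.

Lemma lker_antipode : lker (linfun S) == 0%VS.
Proof. by apply/lker0P => x y; rewrite !lfunE; apply: antipode_inj. Qed.

Lemma antipode_invK : cancel Si S.
Proof.
move=> x; have := lker0_lfunVK lker_antipode x.
by rewrite lfunE.
Qed.

Lemma antipodeK : cancel S Si.
Proof. by move=> x; apply: antipode_inj; rewrite antipode_invK. Qed.

Lemma antipode_invM x y : Si (x * y) = Si y * Si x.
Proof. by apply: antipode_inj; rewrite antipodeM !antipode_invK. Qed.

Lemma counit_antipode_inv x : eps (Si x) = eps x.
Proof. by rewrite -counit_antipode antipode_invK. Qed.

(** S T is a right integral, so S T * T equals both T and S T. *)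
Lemma antipode_int : S T = T.
Proof.
have STr x : S T * x = eps x *: S T.
  by rewrite -{1}[x]antipode_invK -antipodeM Tl linearZ /= counit_antipode_inv.
by have := STr T; rewrite Tl counit_antipode epsT !scale1r.
Qed.

Lemma int_right x : T * x = eps x *: T.
Proof.
by rewrite -{1}[x]antipode_invK -{1}antipode_int -antipodeM Tl linearZ /= counit_antipode_inv antipode_int.
Qed.

Lemma int_swapr (W : lmodType F) (b : H -> H -> W) x :
    (forall v, lin (fun u => b u v)) -> (forall u, lin (b u)) ->
  sw (fun a c => b (a * x) c) T = sw (fun a c => b a (c * S x)) T.
Proof.
move=> b1 b2.
pose t y1 y2 z := sw (fun a c => b (a * y1) (c * y2 * S z)) T.
transitivity (sw (fun y z => sw (fun y1 y2 => t y1 y2 z) y) x); last first.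
  rewrite -(@sw_eps_l F H W (fun z => sw (fun a c => b a (c * S z)) T)); last by lint.
  apply: eq_sw => y z.
  rewrite -(linZ (lin_sw _)) -int_right swM; try by lint.
  by rewrite /t sw_exch.
rewrite swA; try by rewrite /t; lint.
rewrite -(@sw_eps_r F H W (fun z => sw (fun a c => b (a * z) c) T)); last by lint.
apply: eq_sw => y z.
have := @sw_Sr F H W (fun w => sw (fun a c => b (a * y) (c * w)) T) z ltac:(lint).
under [X in _ = _ *: X]eq_sw => a c do rewrite mulr1.
by move=> <-; apply: eq_sw => u v; apply: eq_sw => a c; rewrite mulrA.
Qed.

Lemma coord_basis_elt (i j : 'I_(\dim {:H})) : coord e i e`_j = (i == j)%:R.
Proof. by rewrite coord_free ?(basis_free (vbasisP _)) // eq_sym. Qed.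

Lemma coord_legl (f : H -> F) j x :
  coord e j (sw (fun a c => f a *: c) x) = \sum_(i < \dim {:H}) f e`_i * Dm x i j.
Proof.
rewrite /sw linear_sum; apply: eq_bigr => i _; rewrite linear_sum.
rewrite (bigD1 j) //= big1 ?addr0 => [|k nkj].
  by rewrite !linearZ /= coord_basis_elt eqxx mulr1 mulrC.
by rewrite !linearZ /= coord_basis_elt eq_sym (negPf nkj) !mulr0.
Qed.

Lemma coord_legr (f : H -> F) j x :
  coord e j (sw (fun a c => f c *: a) x) = \sum_i Dm x j i * f e`_i.
Proof.
rewrite /sw exchange_big linear_sum; apply: eq_bigr => i _; rewrite linear_sum.
rewrite (bigD1 j) //= big1 ?addr0 => [|k nkj].
  by rewrite !linearZ /= coord_basis_elt eqxx mulr1.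
by rewrite !linearZ /= coord_basis_elt eq_sym (negPf nkj) !mulr0.
Qed.

(** [int_legl_surj] says that the square matrix of Delta(T) has full row rank.
    Its invertibility gives the injectivity of this map, and both properties for
    the other tensor factor. *)
Lemma comul_int_unit : (comul T : 'M_(\dim {:H})) \in unitmx.
Proof.
rewrite -row_full_unit; apply/row_fullP.
suff /choice[B BP] : forall i, exists u : 'rV_(\dim {:H}), u *m comul T = delta_mx 0 i.
  exists (\matrix_i B i); apply/row_matrixP => i.
  by rewrite row_mul rowK BP row1.
move=> i; have [f lf fT] := int_legl_surj e`_i.
exists (\row_k f e`_k); apply/rowP => j; rewrite !mxE eqxx /=.
rewrite -(coord_basis_elt j i) -fT coord_legl.
by apply: eq_bigr => k _; rewrite mxE.
Qed.

Lemma int_legl_inj (f : H -> F) : linF f -> sw (fun a c => f a *: c) T = 0 ->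
  forall x, f x = 0.
Proof.
move=> lf fT x.
have : (\row_k f e`_k) *m comul T = 0.
  apply/rowP => j; rewrite mxE [RHS]mxE; have := congr1 (coord e j) fT.
  rewrite coord_legl linear0 => Q; apply: etrans Q.
  by apply: eq_bigr => k _; rewrite mxE.
move/(congr1 (mulmxr (invmx (comul T)))); rewrite /= mul0mx mulmxK ?comul_int_unit //.
move=> /rowP f0; rewrite (vec_coord x) (lin_sum lf) big1 // => i _.
by rewrite (linZ lf); have := f0 i; rewrite !mxE => ->; rewrite scaler0.
Qed.

Lemma int_legr_inj (f : H -> F) : linF f -> sw (fun a c => f c *: a) T = 0 ->
  forall x, f x = 0.
Proof.
move=> lf fT x.
have : comul T *m (\col_k f e`_k) = 0.
  apply/colP => j; rewrite mxE [RHS]mxE; have := congr1 (coord e j) fT.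
  rewrite coord_legr linear0 => Q; apply: etrans Q.
  by apply: eq_bigr => k _; rewrite mxE.
move/(congr1 (mulmx (invmx (comul T)))); rewrite /= mulmx0 mulKmx ?comul_int_unit //.
move=> /colP f0; rewrite (vec_coord x) (lin_sum lf) big1 // => i _.
by rewrite (linZ lf); have := f0 i; rewrite !mxE => ->; rewrite scaler0.
Qed.

Lemma int_legr_surj y : exists2 f : H -> F, linF f & sw (fun a c => f c *: a) T = y.
Proof.
pose u := invmx (comul T) *m (\col_k coord e k y).
exists (fun x => \sum_i u i 0 * coord e i x).
  by apply: lin_bigsum => i; apply: lin_mulFr; exact: lin_coord.
rewrite [RHS]vec_coord [LHS]vec_coord; apply: eq_bigr => j _; congr (_ *: _).
transitivity ((comul T *m u) j 0).
  rewrite coord_legr mxE; apply: eq_bigr => i _; congr (_ * _).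
  rewrite (bigD1 i) //= big1 ?addr0 => [|k nki].
    by rewrite coord_basis_elt eqxx mulr1.
  by rewrite coord_basis_elt (negPf nki) mulr0.
by rewrite mulKVmx ?comul_int_unit // mxE.
Qed.

End Integral.

(** * Traces of endomorphisms *)

Section Trace.
Variables (F : fieldType) (V : vectType F).
Local Notation e := (vbasis {:V}).
Implicit Types (P Q : V -> V).

Definition endo_mx P : 'M[F]_(\dim {:V}) := \matrix_(i, j) coord e j (P e`_i).

Definition endo_tr P : F := \sum_i coord e i (P e`_i).

Lemma endo_tr_mx P : endo_tr P = \tr (endo_mx P).
Proof. by apply: eq_bigr => i _; rewrite mxE. Qed.

Lemma eq_endo_tr P Q : P =1 Q -> endo_tr P = endo_tr Q.
Proof. by move=> PQ; apply: eq_bigr => i _; rewrite PQ. Qed.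

Lemma endo_mx_comp P Q : lin Q -> endo_mx (fun x => Q (P x)) = endo_mx P *m endo_mx Q.
Proof.
move=> lQ; apply/matrixP => i j; rewrite !mxE.
rewrite [P _](coord_vbasis (memvf _)) (lin_sum lQ) linear_sum.
by apply: eq_bigr => k _; rewrite (linZ lQ) linearZ !mxE.
Qed.

Lemma endo_mx_inj P Q : lin P -> lin Q -> endo_mx P = endo_mx Q -> P =1 Q.
Proof.
move=> lP lQ PQ x.
rewrite (coord_vbasis (memvf x)) (lin_sum lP) (lin_sum lQ).
apply: eq_bigr => i _; rewrite (linZ lP) (linZ lQ); congr (_ *: _).
rewrite [LHS](coord_vbasis (memvf _)) [RHS](coord_vbasis (memvf _)).
apply: eq_bigr => j _; congr (_ *: _).
by have /matrixP/(_ i j) := PQ; rewrite !mxE.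
Qed.

Lemma endo_tr_cyc P Q : lin P -> lin Q -> endo_tr (fun x => P (Q x)) = endo_tr (fun x => Q (P x)).
Proof. by move=> lP lQ; rewrite !endo_tr_mx (@endo_mx_comp Q P) // (@endo_mx_comp P Q) // mxtrace_mulC. Qed.

Lemma endo_trP a P Q : endo_tr (fun x => a *: P x + Q x) = a * endo_tr P + endo_tr Q.
Proof.
rewrite /endo_tr mulr_sumr -big_split; apply: eq_bigr => i _ /=.
by rewrite linearP.
Qed.

Lemma endo_trD P Q : endo_tr (fun x => P x + Q x) = endo_tr P + endo_tr Q.
Proof. by rewrite /endo_tr -big_split; apply: eq_bigr => i _; rewrite linearD. Qed.

Lemma endo_trZ a P : endo_tr (fun x => a *: P x) = a * endo_tr P.
Proof. by rewrite /endo_tr mulr_sumr; apply: eq_bigr => i _; rewrite linearZ. Qed.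

Lemma endo_tr_id : endo_tr id = (\dim {:V})%:R.
Proof.
rewrite endo_tr_mx -(mxtrace1 F (\dim {:V})); congr (\tr _); apply/matrixP => i j.
by rewrite !mxE coord_free ?(basis_free (vbasisP _)) // eq_sym.
Qed.

Lemma endo_tr_rank1 (f : V -> F) w : linF f -> endo_tr (fun x => f x *: w) = f w.
Proof.
move=> lf; rewrite [w in RHS](coord_vbasis (memvf w)) (lin_sum lf).
by apply: eq_bigr => i _; rewrite linearZ /= (linZ lf) mulrC.
Qed.

Lemma endo_tr_sum I (r : seq I) (P : I -> V -> V) :
  endo_tr (fun x => \sum_(i <- r) P i x) = \sum_(i <- r) endo_tr (P i).
Proof.
rewrite /endo_tr exchange_big; apply: eq_bigr => i _.
by rewrite linear_sum.
Qed.

(** In a rank factorization A = C R of an idempotent, R C is an identity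
    matrix, and tr A = tr(R C). *)
Lemma endo_tr_idem P : lin P -> (forall x, P (P x) = P x) ->
  endo_tr P = (\rank (endo_mx P))%:R.
Proof.
move=> lP PP; rewrite endo_tr_mx; set A := endo_mx P.
have AA : A *m A = A.
  by rewrite -(@endo_mx_comp P P) //; congr endo_mx; apply/funext.
have : row_base A *m col_base A = 1%:M.
  apply: (row_full_inj (col_base_full A)); rewrite mulmx1.
  apply: (row_free_inj (row_base_free A)).
  rewrite -mulmxA -(mulmxA (row_base A)) (mulmx_base A).
  by rewrite (mulmxA (col_base A) (row_base A)) (mulmx_base A).

by move=> bc; rewrite -{1}(mulmx_base A) mxtrace_mulC bc mxtrace1.
Qed.

Lemma endo_tr_sq0 P : lin P -> (forall x, P (P x) = 0) -> endo_tr P = 0.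
Proof.
move=> lP PP; rewrite endo_tr_mx; set A := endo_mx P.
have AA : A *m A = 0.
  by rewrite -(@endo_mx_comp P P) //; apply/matrixP => i j; rewrite !mxE PP linear0.
have : row_base A *m col_base A = 0.
  apply: (row_full_inj (col_base_full A)); rewrite mulmx0.
  apply: (row_free_inj (row_base_free A)).
  rewrite mul0mx -mulmxA -(mulmxA (row_base A)) (mulmx_base A).
  by rewrite (mulmxA (col_base A) (row_base A)) (mulmx_base A).
by move=> bc; rewrite -{1}(mulmx_base A) mxtrace_mulC bc mxtrace0.
Qed.

Lemma endo_mx_rank0 P : lin P -> \rank (endo_mx P) = 0%N -> forall x, P x = 0.
Proof.
move=> lP /eqP; rewrite mxrank_eq0 => /eqP P0.
apply: (endo_mx_inj lP) => [a x y|]; first by rewrite scaler0 addr0.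
by rewrite P0; apply/matrixP => i j; rewrite !mxE linear0.
Qed.

End Trace.

(** * The integral on H and its Nakayama automorphism *)

Section RightIntegralForm.
Variables (F : fieldType) (H : hopfType F).
Implicit Types (x y : H).
Local Notation S := (@antipode F H).
Local Notation eps := (@counit F H).
Local Notation Si := (@antipode_inv F H).
Local Notation e := (vbasis {:H}).
Variable T : H.
Hypothesis Tl : forall x, x * T = eps x *: T.
Hypothesis epsT : eps T = 1.

Variable rho : H -> F.
Hypothesis lrho : linF rho.
Hypothesis rhoT : sw (fun a c => rho c *: a) T = 1.

Let leps := @lin_counit_id F H.

Lemma rho_int_T : rho T = 1.
Proof.
have := congr1 eps rhoT; rewrite counit1 => <-.
rewrite (@sw_lin F H H F^o eps) //.
rewrite -(@sw_eps_l F H F^o rho) //.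
by apply: (@eq_sw F H F^o) => a c; rewrite linearZ /= mulrC.
Qed.

(** For a functional f, put psi(z) = f(z_1) rho(z_2).  Then T_1 psi(T_2) is
    f(1) 1, as it is for f(1) rho in place of psi, so the two functionals agree by
    [int_legr_inj]. *)
Lemma rho_int x : sw (fun a c => rho c *: a) x = rho x *: 1.
Proof.
rewrite [LHS]vec_coord [RHS]vec_coord; apply: eq_bigr => i _; congr (_ *: _).
pose f := coord e i : H -> F.
have lf : linF f by exact: lin_coord.
pose psi z := f (sw (fun a c => rho c *: a) z).
have lpsi : linF psi by rewrite /psi; apply: (lin_comp lf (lin_sw _)).
transitivity (rho x * f 1); last by rewrite linearZ.
rewrite -/(psi x); apply/eqP; rewrite -subr_eq0; apply/eqP.
apply: (@int_legr_inj F H T Tl epsT (fun x => psi x - rho x * f 1)).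
  by apply: lin_add => //; apply: lin_opp; apply: lin_mulFl.
pose Q p : H := sw (fun a u => f u *: a) p.
have lQ : lin Q by exact: lin_sw.
have psiT : sw (fun a c => psi c *: a) T = f 1 *: 1.
  transitivity (sw (fun a c => sw (fun u v => (rho v * f u) *: a) c) T).
    apply: eq_sw => a c; rewrite /psi (@sw_lin F H H F^o f) //.
    rewrite (@sw_lin F H F^o H (fun z => (z : F) *: a)); last first.
      by apply: (@lin_scalel _ F^o H id a); exact: lin_id.
    by apply: eq_sw => u v; rewrite (linZ lf).
  rewrite -(@swA F H H (fun a u v => (rho v * f u) *: a)); first last.
  - by move=> u v; apply: lin_scalel; apply: lin_mulFl.
  - by move=> u v; apply: lin_scalel; apply: lin_mulFr.
  - by lint.
  transitivity (Q 1); last by rewrite /Q sw1 //; lint.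
  rewrite -rhoT (@sw_lin F H H H Q) //; apply: eq_sw => p v.
  rewrite (linZ lQ) /Q (@sw_lin F H H H (fun z => rho v *: z)); last by lint.
  by apply: eq_sw => a u; rewrite scalerA.
transitivity (sw (fun a c => psi c *: a) T - f 1 *: sw (fun a c => rho c *: a) T).
  rewrite (@sw_lin F H H H (fun z => f 1 *: z)); last by lint.
  rewrite /sw -sumrB; apply: eq_bigr => k _; rewrite -sumrB; apply: eq_bigr => l _.
  by rewrite -scalerBr scalerBl scalerA [rho _ * _]mulrC.
by rewrite psiT rhoT subrr.
Qed.

Lemma rho_swapl x : sw (fun a c => rho (x * c) *: a) T = S x.
Proof.
rewrite -(@int_swapl F H T Tl H (fun a c => rho c *: a)); try lint.
transitivity (sw (fun a c => S x * (rho c *: a)) T).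
  by apply: eq_sw => a c; rewrite scalerAr.
by rewrite -(@sw_lin F H H H (fun z => S x * z)) ?rhoT ?mulr1 //; lint.
Qed.

Lemma rho_swapr x : sw (fun a c => rho (c * S x) *: a) T = x.
Proof.
rewrite -(@int_swapr F H T Tl epsT H (fun a c => rho c *: a)); try lint.
transitivity (sw (fun a c => (rho c *: a) * x) T).
  by apply: eq_sw => a c; rewrite scalerAl.
by rewrite -(@sw_lin F H H H (fun z => z * x)) ?rhoT ?mul1r //; lint.
Qed.

(** By [rho_swapl], and by [rho_swapr] at S x, the functionals rho(x -) and
    rho(- S^2 x) have the same value S x on the second leg of T, which determines
    them. *)
Lemma rho_nakayama x y : rho (x * y) = rho (y * S (S x)).
Proof.
apply/eqP; rewrite -subr_eq0; apply/eqP; move: y.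
apply: (@int_legr_inj F H T Tl epsT (fun y => rho (x * y) - rho (y * S (S x)))).
  by apply: lin_add; [|apply: lin_opp]; apply: (lin_comp lrho); lint.
transitivity (sw (fun a c => rho (x * c) *: a) T - sw (fun a c => rho (c * S (S x)) *: a) T).
  rewrite /sw -sumrB; apply: eq_bigr => k _; rewrite -sumrB; apply: eq_bigr => l _.
  by rewrite -scalerBr scalerBl.
by rewrite rho_swapl rho_swapr subrr.
Qed.

Lemma rho_nondeg x : (forall y, rho (x * y) = 0) -> x = 0.
Proof.
move=> rx; apply: (@antipode_inj F H T Tl epsT); rewrite linear0 -rho_swapl.
rewrite /sw big1 // => i _; rewrite big1 // => j _.
by rewrite rx scale0r scaler0.
Qed.

(** [rho_swapr] writes the identity of H as a sum of operators of rank one. *)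
Lemma endo_tr_rhor (U : H -> H) : lin U -> endo_tr U = @sw F H F^o (fun a c => rho (c * S (U a))) T.
Proof.
move=> lU; transitivity (endo_tr (fun x => sw (fun a c => rho (c * S x) *: U a) T)).
  apply: eq_endo_tr => x; rewrite -{1}[x]rho_swapr (sw_lin _ _ lU).
  by apply: eq_sw => a c; rewrite (linZ lU).
rewrite /sw endo_tr_sum; apply: eq_bigr => i _; rewrite endo_tr_sum; apply: eq_bigr => j _.
rewrite endo_trZ endo_tr_rank1 //; apply: (lin_comp lrho); lint.
Qed.

(** Same as [endo_tr_rhor], starting from the inverse of S applied to
    [rho_swapl]. *)
Lemma endo_tr_rhol (U : H -> H) : lin U -> endo_tr U = @sw F H F^o (fun a c => rho (U (Si a) * c)) T.
Proof.
move=> lU; transitivity (endo_tr (fun x => sw (fun a c => rho (x * c) *: U (Si a)) T)).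
  apply: eq_endo_tr => x; rewrite -{1}[x](antipodeK Tl epsT) -(rho_swapl x).
  rewrite (@sw_lin F H H H (fun z => U (Si z))); last exact: (lin_comp lU (@lin_antipode_inv F H)).
  by apply: eq_sw => a c; rewrite (linZ (@lin_antipode_inv F H)) (linZ lU).
rewrite /sw endo_tr_sum; apply: eq_bigr => i _; rewrite endo_tr_sum; apply: eq_bigr => j _.
rewrite endo_trZ endo_tr_rank1 //; apply: (lin_comp lrho); lint.
Qed.

End RightIntegralForm.

(** * The distinguished grouplike element and the fourth power of the antipode *)

Section Distinguished.
Variables (F : fieldType) (H : hopfType F).
Implicit Types (x y : H).
Local Notation S := (@antipode F H).
Local Notation eps := (@counit F H).
Local Notation Si := (@antipode_inv F H).
Local Notation e := (vbasis {:H}).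
Variable T : H.
Hypothesis Tl : forall x, x * T = eps x *: T.
Hypothesis epsT : eps T = 1.
Variable rho : H -> F.
Hypothesis lrho : linF rho.
Hypothesis rhoT : sw (fun a c => rho c *: a) T = 1.

Let rhoI := rho_int Tl epsT lrho rhoT.
Let rhoN := rho_nakayama Tl epsT lrho rhoT.

(** A functional nu is determined by T_1 nu(T_2), which is nu(T) 1 for an
    integral. *)
Lemma rho_unique (nu : H -> F) : linF nu ->
    (forall x, sw (fun a c => nu c *: a) x = nu x *: 1) ->
  forall x, nu x = nu T * rho x.
Proof.
move=> lnu nuI x; apply/eqP; rewrite -subr_eq0; apply/eqP; move: x.
apply: (@int_legr_inj F H T Tl epsT (fun x => nu x - nu T * rho x)).
  by apply: lin_add => //; apply: lin_opp; apply: lin_mulFr.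
transitivity (sw (fun a c => nu c *: a) T - nu T *: sw (fun a c => rho c *: a) T).
  rewrite (@sw_lin F H H H (fun z => nu T *: z)); last by lint.
  rewrite /sw -sumrB; apply: eq_bigr => k _; rewrite -sumrB; apply: eq_bigr => l _.
  by rewrite -scalerBr scalerBl scalerA.
by rewrite nuI rhoT subrr.
Qed.

(** The distinguished grouplike element of H, which measures how far
    rho is from being an integral on the other side. *)
Definition modular : H := sw (fun a c => rho a *: c) T.
Local Notation g := modular.

(** For every functional f, rho(z_1) f(z_2) is again an integral, hence a
    multiple of rho. *)
Lemma rho_modular x : sw (fun a c => rho a *: c) x = rho x *: g.
Proof.
rewrite [LHS]vec_coord [RHS]vec_coord; apply: eq_bigr => i _; congr (_ *: _).
pose f := coord e i : H -> F.
have lf : linF f by exact: lin_coord.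
pose nu z := f (sw (fun a c => rho a *: c) z).
have lnu : linF nu by rewrite /nu; apply: (lin_comp lf (lin_sw _)).
rewrite linearZ /= -/(f _) -/(nu x) -[coord e i g]/(nu T) mulrC.
apply: rho_unique => // {}x.
transitivity (sw (fun a c => sw (fun u v => (rho u * f v) *: a) c) x).
  apply: eq_sw => a c; rewrite /nu (@sw_lin F H H F^o f) //.
  rewrite (@sw_lin F H F^o H (fun z => (z : F) *: a)); last first.
    by apply: (@lin_scalel _ F^o H id a); exact: lin_id.
  by apply: eq_sw => u v; rewrite (linZ lf).
rewrite -(@swA F H H (fun a u v => (rho u * f v) *: a)); first last.
- by move=> u v; apply: lin_scalel; apply: lin_mulFr.
- by move=> u v; apply: lin_scalel; apply: lin_mulFl.
- by lint.
transitivity (sw (fun p v => (rho p * f v) *: (1 : H)) x).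
  apply: eq_sw => p v; rewrite mulrC -scalerA -rhoI.
  rewrite (@sw_lin F H H H (fun z => f v *: z)); last by lint.
  by apply: eq_sw => a u; rewrite scalerA mulrC.
rewrite /nu (@sw_lin F H H F^o f) //.
rewrite (@sw_lin F H F^o H (fun z => (z : F) *: (1 : H))); last first.
  by apply: (@lin_scalel _ F^o H id (1 : H)); exact: lin_id.
by apply: eq_sw => u v; rewrite (linZ lf).
Qed.

(** Delta(h) = h (x) h, tested on all bilinear maps. *)
Definition grouplike (h : H) := forall (W : lmodType F) (b : H -> H -> W),
  (forall v, lin (fun u => b u v)) -> (forall u, lin (b u)) -> sw b h = b h h.

Lemma modular_grouplike : grouplike g.
Proof.
move=> W b b1 b2; rewrite /g (sw_lin _ _ (lin_sw b)).
transitivity (sw (fun a c => sw (fun u v => rho a *: b u v) c) T).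
  apply: eq_sw => a c; rewrite (linZ (lin_sw b)).
  by rewrite (@sw_lin F H W W (fun z => rho a *: z)) //; lint.
rewrite -(@swA F H W (fun a u v => rho a *: b u v)); first last.
- by lint.
- by lint.
- by move=> v w; apply: lin_scalel.
transitivity (sw (fun p v => rho p *: b g v) T).
  apply: eq_sw => p v; rewrite -(linZ (b1 v)) -rho_modular.
  rewrite (@sw_lin F H H W (fun z => b z v)) //.
  by apply: eq_sw => a u; rewrite (linZ (b1 v)).
by rewrite [RHS](sw_lin _ _ (b2 _)); apply: eq_sw => a c; rewrite (linZ (b2 _)).
Qed.

Lemma counit_modular : eps g = 1.
Proof.
rewrite /g (@sw_lin F H H F^o eps); last exact: lin_counit_id.
rewrite -(rho_int_T lrho rhoT) -[rho T](@sw_eps_r F H F^o rho T) //.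
by apply: (@eq_sw F H F^o) => a c; rewrite linearZ /= mulrC.
Qed.

Lemma grouplike_Sl h : grouplike h -> eps h = 1 -> S h * h = 1.
Proof.
move=> gh eh; have := @sw_Sl F H H id h ltac:(lint).
by rewrite gh; [rewrite eh scale1r | lint | lint].
Qed.

Lemma grouplike_Sr h : grouplike h -> eps h = 1 -> h * S h = 1.
Proof.
move=> gh eh; have := @sw_Sr F H H id h ltac:(lint).
by rewrite gh; [rewrite eh scale1r | lint | lint].
Qed.

Let gSg := grouplike_Sr modular_grouplike counit_modular.
Let Sgg := grouplike_Sl modular_grouplike counit_modular.

Lemma S2_modular : S (S g) = g.
Proof.
have : S g * S (S g) = 1 by rewrite -antipodeM Sgg antipode1.
by move/(congr1 ( *%R g)); rewrite mulrA gSg mul1r mulr1.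
Qed.

Let lam x := rho (g * x).
Let llam : linF lam. Proof. by apply: (lin_comp lrho); lint. Qed.

(** Translating rho by the distinguished grouplike turns it into an integral
    on the other side. *)
Lemma lam_int x : sw (fun a c => lam a *: c) x = lam x *: 1.
Proof.
have : sw (fun a c => rho a *: c) (g * x) = sw (fun u v => lam u *: (g * v)) x.
  rewrite swM; [|lint|lint].
  rewrite modular_grouplike //; last by lint.
  by move=> v; apply: lin_sw_in => a c; apply: lin_scalel; apply: (lin_comp lrho); lint.
rewrite rho_modular => /(congr1 ( *%R (S g))).
rewrite (@sw_lin F H H H (fun z => S g * z)); last by lint.
rewrite -scalerAr Sgg => ->.
by apply: eq_sw => u v; rewrite -scalerAr mulrA Sgg mul1r.
Qed.

(** The mirror image of [rho_nakayama]: the Nakayama automorphism of the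
    integral on the other side is the inverse of S^2. *)
Lemma lam_nakayama x y : lam (S (S x) * y) = lam (y * x).
Proof.
have lamT : sw (fun a c => lam a *: c) T = 1.
  by rewrite lam_int /lam Tl counit_modular scale1r rho_int_T ?scale1r.
have Q1 z : sw (fun a c => lam (S z * a) *: c) T = z.
  rewrite (@int_swapl F H T Tl H (fun a c => lam a *: c)); try lint.
  transitivity (sw (fun a c => z * (lam a *: c)) T).
    by apply: eq_sw => a c; rewrite scalerAr.
  by rewrite -(@sw_lin F H H H (fun u => z * u)) ?lamT ?mulr1 //; lint.
have Q2 z : sw (fun a c => lam (a * z) *: c) T = S z.
  rewrite (@int_swapr F H T Tl epsT H (fun a c => lam a *: c)); try lint.
  transitivity (sw (fun a c => (lam a *: c) * S z) T).
    by apply: eq_sw => a c; rewrite scalerAl.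
  by rewrite -(@sw_lin F H H H (fun u => u * S z)) ?lamT ?mul1r //; lint.
apply/eqP; rewrite -subr_eq0; apply/eqP; move: y.
apply: (@int_legl_inj F H T Tl epsT (fun y => lam (S (S x) * y) - lam (y * x))).
  by apply: lin_add; [|apply: lin_opp]; apply: (lin_comp llam); lint.
transitivity (sw (fun a c => lam (S (S x) * a) *: c) T - sw (fun a c => lam (a * x) *: c) T).
  rewrite /sw -sumrB; apply: eq_bigr => k _; rewrite -sumrB; apply: eq_bigr => l _.
  by rewrite -scalerBr scalerBl.
by rewrite Q1 Q2 subrr.
Qed.

Lemma rho_nondeg_r x : (forall y, rho (y * x) = 0) -> x = 0.
Proof.
move=> rx; rewrite -[x](antipode_invK Tl epsT) -[Si x](antipode_invK Tl epsT).
rewrite (_ : Si (Si x) = 0) ?linear0 //.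
apply: (rho_nondeg Tl epsT lrho rhoT) => y.
by rewrite rhoN !(antipode_invK Tl epsT).
Qed.

(** Radford's formula for S^4 when the integral of H is two-sided: rho and its
    translate by g have Nakayama automorphisms S^2 and its inverse, and two forms
    that differ by a translation have Nakayama automorphisms that differ by the
    corresponding conjugation. *)
Lemma radford x : g * S (S (S (S x))) = x * g.
Proof.
apply/eqP; rewrite -subr_eq0; apply/eqP; apply: rho_nondeg_r => y.
have E1 : lam (S (S x) * y) = rho (y * (g * S (S (S (S x))))).
  by rewrite /lam mulrA rhoN !antipodeM S2_modular.
have E2 : lam (y * x) = rho (y * (x * g)).
  by rewrite /lam rhoN S2_modular mulrA.
have lry : linF (fun z => rho (y * z)) by apply: (lin_comp lrho); lint.
by rewrite -scaleN1r addrC lry -E1 -E2 lam_nakayama scaleN1r addNr.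
Qed.

End Distinguished.

Section GrouplikeOrder.
Variables (F : fieldType) (H : hopfType F).
Local Notation eps := (@counit F H).

Lemma grouplike1 : grouplike (1 : H).
Proof. by move=> W b b1 b2; apply: sw1. Qed.

Lemma grouplikeM (h k : H) : grouplike h -> grouplike k -> grouplike (h * k).
Proof.
move=> gh gk W b b1 b2; rewrite swM //.
by rewrite gh; [rewrite gk; [|lint|lint] | lint | lint].
Qed.

Lemma grouplikeX (h : H) n : grouplike h -> grouplike (h ^+ n).
Proof.
move=> gh; elim: n => [|n IHn]; first exact: grouplike1.
by rewrite exprS; apply: grouplikeM.
Qed.

(** The first linear relation among the powers of g expresses g ^+ k by
    linearly independent powers.  Applying f (x) id to its coproduct, with f a
    coordinate of these powers, leaves a single power on the right, so g ^+ k is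
    one of the earlier powers. *)
Lemma grouplike_order (g g' : H) : grouplike g -> g' * g = 1 ->
  exists2 k, (0 < k)%N & g ^+ k = 1.
Proof.
move=> gg g'g.
have gX0 k : g ^+ k != 0.
  have : g' ^+ k * g ^+ k = 1.
    elim: k => [|k IHk]; first by rewrite mulr1.
    by rewrite exprSr exprS mulrA -(mulrA (g' ^+ k)) g'g mulr1.
  by apply: contra_eq_neq => ->; rewrite mulr0 eq_sym oner_neq0.
pose X k := [seq g ^+ i | i <- rev (iota 0 k)].
have XS k : X k.+1 = g ^+ k :: X k.
  by rewrite /X -addn1 iotaD add0n rev_cat.
have szX k : size (X k) = k by rewrite size_map size_rev size_iota.
have [k fX gk] : exists2 k, free (X k) & g ^+ k \in <<X k>>%VS.
  have : ~~ free (X (\dim {:H}).+1).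
    apply/negP => fX; have := dim_span (X (\dim {:H}).+1).
    have : (\dim <<X (\dim {:H}).+1>> <= \dim {:H})%N by apply: dimvS; exact: subvf.
    by rewrite (eqnP fX) szX ltnn.
  elim: (_.+1) => [|k IHk]; first by rewrite nil_free.
  rewrite XS free_cons negb_and negbK; case: (boolP (free (X k))) => fX.
    by rewrite orbF => gX; exists k.
  by move=> _; apply: IHk.
pose Y := in_tuple (X k).
have [j aj] : exists j, coord Y j (g ^+ k) != 0.
  apply/existsP; apply: contraT; rewrite negb_exists => /forallP a0.
  have := gX0 k; rewrite (coord_span (X := Y) gk) big1 ?eqxx // => i _.
  by have := a0 i; rewrite negbK => /eqP ->; rewrite scale0r.
pose f := coord Y j : H -> F.
have lf : linF f by exact: lin_linear.
pose Q h := sw (fun a c => f a *: c) h.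
have lQ : lin Q by exact: lin_sw.
have QX i : Q (g ^+ i) = f (g ^+ i) *: g ^+ i.
  by rewrite /Q grouplikeX //; lint.
have Yi (i : 'I_(size (X k))) : exists2 l, (l < k)%N & Y`_i = g ^+ l.
  have : Y`_i \in X k by exact: mem_nth.
  by case/mapP => l; rewrite mem_rev mem_iota => lk ->; exists l.
have : Q (g ^+ k) = f (g ^+ k) *: Y`_j.
  rewrite {1}(coord_span (X := Y) gk) (lin_sum lQ) (bigD1 j) //= big1 ?addr0.
    have [l _ Yl] := Yi j; rewrite (linZ lQ) Yl QX -Yl /f coord_free //.
    by rewrite eqxx scale1r.
  move=> i ni; have [l _ Yl] := Yi i; rewrite (linZ lQ) Yl QX -Yl /f coord_free //.
  by rewrite (negPf ni) scale0r scaler0.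
rewrite QX => /(scalerI aj); have [l lk ->] := Yi j => gkl.
exists (k - l)%N; first by rewrite subn_gt0.
have gl : g' ^+ l * g ^+ l = 1.
  elim: l {lk gkl} => [|l IHl]; first by rewrite mulr1.
  by rewrite exprSr exprS mulrA -(mulrA (g' ^+ l)) g'g mulr1.
move/(congr1 ( *%R (g' ^+ l))): gkl.
by rewrite -(subnKC (ltnW lk)) exprD mulrA gl mul1r subnKC ?(ltnW lk).
Qed.

End GrouplikeOrder.

(** * The regular character *)

Section RegularTrace.
Variables (F : fieldType) (A : falgType F).
Implicit Types (x y : A).

Definition regchar (x : A) : F := endo_tr (fun y => x * y).

Lemma lin_regchar : linF (regchar).
Proof.
move=> a x y; suff E : regchar (a *: x + y) = a * regchar x + regchar y by exact: E.
by rewrite /regchar -endo_trP; apply: eq_endo_tr => z; rewrite mulrDl scalerAl.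
Qed.

Lemma regcharC (x y : A) : regchar (x * y) = regchar (y * x).
Proof.
have lm (z : A) : lin (fun u => z * u) by apply: lin_mulr; exact: lin_id.
rewrite /regchar (_ : (fun z => x * y * z) = fun z => x * (y * z)).
  by rewrite endo_tr_cyc //; apply: eq_endo_tr => z; rewrite mulrA.
by apply/funext => z; rewrite mulrA.
Qed.

End RegularTrace.

Section TraceForms.
Variables (F : fieldType) (H : hopfType F).
Implicit Types (x y : H).
Local Notation S := (@antipode F H).
Local Notation eps := (@counit F H).
Local Notation Si := (@antipode_inv F H).
Variable T : H.
Hypothesis Tl : forall x, x * T = eps x *: T.
Hypothesis epsT : eps T = 1.
Variable rho : H -> F.
Hypothesis lrho : linF rho.
Hypothesis rhoT : sw (fun a c => rho c *: a) T = 1.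

(** The density of the regular character with respect to rho. *)
Definition omega : H := sw (fun a c => Si a * c) T.

Lemma regchar_rho x : regchar x = rho (x * omega).
Proof.
rewrite /regchar (endo_tr_rhol Tl epsT lrho rhoT); last by lint.
rewrite /omega (@sw_lin F H H F^o (fun z => rho (x * z))); last first.
  by apply: (lin_comp lrho); lint.
by apply: (@eq_sw F H F^o) => a c; rewrite mulrA.
Qed.

(** The regular character is symmetric, whereas rho has Nakayama automorphism
    S^2: the density intertwines the two. *)
Lemma omega_S2 x : omega * S (S x) = x * omega.
Proof.
apply/eqP; rewrite -subr_eq0; apply/eqP.
apply: (rho_nondeg_r Tl epsT lrho rhoT) => y.
have lry : linF (fun z => rho (y * z)) by apply: (lin_comp lrho); lint.
rewrite -scaleN1r addrC lry.
have -> : rho (y * (x * omega)) = rho (x * y * omega).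
  by rewrite mulrA -regchar_rho regcharC regchar_rho.
by rewrite -mulrA (rho_nakayama Tl epsT lrho rhoT x) -mulrA scaleN1r addNr.
Qed.

Lemma counit_omega : eps omega = 1.
Proof.
rewrite /omega (@sw_lin F H H F^o eps); last exact: lin_counit_id.
transitivity (@sw F H F^o (fun a c => eps a *: (eps c : F^o)) T).
  by apply: (@eq_sw F H F^o) => a c; rewrite counitM (counit_antipode_inv Tl epsT).
by rewrite (@sw_eps_l F H F^o eps) //; exact: lin_counit_id.
Qed.

Lemma regchar_int : regchar T = 1.
Proof.
rewrite regchar_rho (int_right Tl epsT) counit_omega scale1r.
exact: (rho_int_T lrho rhoT).
Qed.

Lemma endo_tr_S2 : endo_tr (fun x => S (S x)) = rho 1.
Proof.
rewrite (endo_tr_rhol Tl epsT lrho rhoT); last by lint.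
transitivity (@sw F H F^o (fun a c => rho (S a * c)) T).
  by apply: (@eq_sw F H F^o) => a c; rewrite (antipode_invK Tl epsT).
by rewrite (@sw_Sl F H F^o rho) // epsT scale1r.
Qed.

(** The coproducts collapse in [endo_tr_rhor]: the inverse of S applied to the
    middle leg of T meets its last leg. *)
Lemma endo_tr_Si2_leg (f : H -> F) : linF f ->
  endo_tr (fun x => Si (Si (sw (fun a c => f a *: c) x))) = rho 1 * f T.
Proof.
move=> lf; pose Q := sw (fun a c => f a *: c).
have lSi : lin Si by exact: lin_antipode_inv.
have lQ : lin Q by exact: lin_sw.
rewrite (endo_tr_rhor Tl epsT lrho rhoT); last by apply: (lin_comp lSi); apply: (lin_comp lSi).
transitivity (@sw F H F^o (fun a c => @sw F H F^o (fun u v => f u * rho (c * Si v)) a) T).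
  apply: (@eq_sw F H F^o) => a c; rewrite (antipode_invK Tl epsT).
  rewrite (@sw_lin F H H F^o (fun z => rho (c * Si z))); last first.
    by apply: (lin_comp lrho); lint.
  apply: (@eq_sw F H F^o) => u v; rewrite (linZ lSi) -scalerAr.
  exact: (linZ lrho).
rewrite (@swA F H F^o (fun u v c => f u * rho (c * Si v))); first last.
- by move=> u v; apply: lin_mulFr; apply: (lin_comp lrho); lint.
- by move=> u v; apply: lin_mulFr; apply: (lin_comp lrho); lint.
- by move=> u v; apply: lin_mulFl.
transitivity (@sw F H F^o (fun u r => eps r *: (f u * rho 1 : F^o)) T).
  apply: (@eq_sw F H F^o) => u r.
  have lphi : linF (fun z => f u * rho (Si z)).
    by apply: lin_mulFr; apply: (lin_comp lrho).
  have Si1 : Si 1 = 1 by apply: (antipode_inj Tl epsT); rewrite (antipode_invK Tl epsT) antipode1.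
  have := sw_Sr r lphi; rewrite Si1 => <-.
  apply: (@eq_sw F H F^o) => v c.
  by rewrite (antipode_invM Tl epsT) (antipodeK Tl epsT).
rewrite (@sw_eps_r F H F^o (fun u => f u * rho 1)); first by rewrite mulrC.
by apply: lin_mulFl.
Qed.

End TraceForms.

(** * Traces of idempotents, nilpotents and roots of scalars *)

Section Annihilator.
Variables (F : fieldType) (A : falgType F).
Implicit Types (z : A) (p q : {poly F}).

Lemma horner_algZ z c p : horner_alg z (c *: p) = c *: horner_alg z p.
Proof. by rewrite linearZ /= mulr_algl. Qed.

Lemma horner_algE z p : horner_alg z p = \sum_(i < size p) p`_i *: z ^+ i.
Proof.
rewrite -{1}[p]coefK poly_def linear_sum; apply: eq_bigr => i _.
by rewrite /= horner_algZ rmorphXn /= horner_algX.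
Qed.

(** The powers 1, z, ..., z ^+ N are too many to be linearly independent. *)
Lemma annihilator z : exists2 p, p != 0 & horner_alg z p = 0.
Proof.
pose N := \dim {:A}.
pose M : 'M[F]_(N.+1, N) := \matrix_(i, j) coord (vbasis {:A}) j (z ^+ i).
have : kermx M != 0.
  rewrite -mxrank_eq0 mxrank_ker subn_eq0 -ltnNge ltnS.
  exact: rank_leq_col.
case/rowV0Pn=> u /sub_kermxP uM nu.
exists (\sum_i u 0 i *: 'X^i).
  apply: contraNneq nu => p0; apply/eqP/rowP => k; rewrite mxE.
  transitivity ((\sum_i u 0 i *: 'X^i)`_k); last by rewrite p0 coef0.
  rewrite coef_sum (bigD1 k) //= big1 ?addr0; first by rewrite coefZ coefXn eqxx mulr1.
  by move=> i ni; rewrite coefZ coefXn eq_sym (inj_eq val_inj) (negPf ni) mulr0.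
rewrite linear_sum /=.
rewrite [LHS](coord_vbasis (memvf _)) big1 // => j _.
have /rowP/(_ j) := uM; rewrite [RHS]mxE mxE => uj.
apply: etrans (scale0r _); congr (_ *: _); apply: etrans uj.
rewrite linear_sum; apply: eq_bigr => i _.
by rewrite horner_algZ linearZ /= rmorphXn /= horner_algX mxE.
Qed.

End Annihilator.

Section TraceRank.
Variables (F : numClosedFieldType) (A : falgType F).
Implicit Types (x y z e f g : A) (p q : {poly F}).
Local Notation chi := (@regchar F A).

Lemma lin_mulA x : lin (fun y => x * y). Proof. by apply: lin_mulr; exact: lin_id. Qed.

Definition mulrank x : nat := \rank (endo_mx (fun y => x * y)).

Lemma regchar_idem e : e * e = e -> chi e = (mulrank e)%:R.
Proof.
by move=> ee; apply: endo_tr_idem => [|y]; [exact: lin_mulA | rewrite mulrA ee].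
Qed.

Lemma mulrank0 e : mulrank e = 0%N -> e = 0.
Proof.
by move=> e0; rewrite -[e]mulr1; apply: (endo_mx_rank0 (lin_mulA e)).
Qed.

Lemma regchar_sq0 z : z * z = 0 -> chi z = 0.
Proof.
by move=> zz; apply: endo_tr_sq0 => [|y]; [exact: lin_mulA | rewrite mulrA zz mul0r].
Qed.

(** If p(z) = 0 with p = r X ^+ m and r(0) != 0, the Bezout relation between
    X ^+ m.+1 and r yields an idempotent polynomial in z without constant term.
    Its trace vanishes, and it is its rank, so the idempotent is 0 and z ^+ m
    vanishes too. *)
Lemma trace0_nilpotent z : (forall k, chi (z ^+ k.+1) = 0) ->
  exists n, z ^+ n = 0.
Proof.
move=> tr0; have [p pn0 pz] := annihilator z.
have chi0 q : chi (horner_alg z (q * 'X)) = 0.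
  have lchi := @lin_regchar F A.
  rewrite rmorphM /= horner_algX horner_algE mulr_suml (lin_sum lchi) big1 // => i _.
  by rewrite -scalerAl -exprSr (linZ lchi) tr0 scaler0.
have [m [r /implyP/(_ pn0) r0 pE]] := multiplicity_XsubC p 0.
rewrite subr0 in pE.
have [[u v] /= uv] : exists w : {poly F} * {poly F}, w.1 * 'X^(m.+1) + w.2 * r = 1.
  apply/Bezout_eq1_coprimepP; rewrite coprimep_expl // coprimep_sym.
  by rewrite -['X]subr0 coprimep_XsubC.
pose e := horner_alg z (u * 'X^(m.+1)).
have e1 : 1 - e = horner_alg z (v * r).
  by apply/eqP; rewrite subr_eq -rmorphD addrC uv rmorph1.
have ee : e * e = e.
  apply/eqP; rewrite eq_sym -subr_eq0 -{1}[e]mulr1 -mulrBr e1 -rmorphM /=.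
  rewrite (_ : _ * (v * r) = u * v * 'X * p); last by rewrite pE exprSr; ring.
  by rewrite rmorphM /= pz mulr0.
have e0 : e = 0.
  apply: mulrank0; apply/eqP; rewrite -(pnatr_eq0 F) -regchar_idem //.
  by rewrite /e exprSr mulrA chi0.
exists m; rewrite -{1}[z]horner_algX -rmorphXn /= -['X^m]mulr1 -uv.
rewrite (_ : 'X^m * _ = 'X^m * (u * 'X^(m.+1)) + v * p); last by rewrite pE; ring.
by rewrite rmorphD (rmorphM _ 'X^m) (rmorphM _ v) /= -/e e0 pz !mulr0 addr0.
Qed.

(** Lagrange interpolation at distinct roots makes z a combination of
    idempotents, the traces of which are natural numbers. *)
Lemma spectral_trace (rs : seq F) z : uniq rs ->
    horner_alg z (\prod_(t <- rs) ('X - t%:P)) = 0 ->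
  exists n : F -> nat, forall q, chi (horner_alg z q) = \sum_(t <- rs) q.[t] * (n t)%:R.
Proof.
move=> urs rsz.
have eqq p q : (forall t, t \in rs -> p.[t] = q.[t]) -> horner_alg z p = horner_alg z q.
  move=> pq; apply/eqP; rewrite -subr_eq0 -rmorphB /=; apply/eqP.
  have : (\prod_(t <- rs) ('X - t%:P)) %| p - q.
    apply: uniq_roots_dvdp; last by rewrite uniq_rootsE.
    by apply/allP => t /pq pqt; rewrite rootE !hornerE pqt subrr.
  by case/dvdpP => r ->; rewrite rmorphM /= rsz mulr0.
pose d t := \prod_(s <- rs | s != t) (t - s).
pose l t : {poly F} := (d t)^-1 *: \prod_(s <- rs | s != t) ('X - s%:P).
have lE t s : t \in rs -> s \in rs -> (l t).[s] = (s == t)%:R.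
  move=> tr sr; rewrite /l hornerZ horner_prod.
  have [-> | nst] := eqVneq s t.
    under eq_bigr => k _ do rewrite hornerXsubC.
    rewrite mulVf // /d prodf_seq_neq0; apply/allP => k _.
    by apply/implyP; rewrite subr_eq0 eq_sym.
  rewrite (big_rem s) //= nst hornerXsubC subrr mul0r mulr0 //.
pose ev t := horner_alg z (l t).
have evi t : t \in rs -> ev t * ev t = ev t.
  move=> tr; rewrite /ev -rmorphM; apply: eqq => s sr.
  by rewrite hornerM lE //; case: eqP; rewrite ?mulr1 ?mulr0.
exists (fun t => mulrank (ev t)) => q.
transitivity (\sum_(t <- rs) q.[t] * chi (ev t)); last first.
  by rewrite big_seq [RHS]big_seq; apply: eq_bigr => t tr; rewrite regchar_idem ?evi.
have lchi := @lin_regchar F A.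
rewrite (eqq q (\sum_(t <- rs) q.[t] *: l t)) => [|s sr].
  rewrite linear_sum (lin_sum lchi); apply: eq_bigr => t _.
  by rewrite /= horner_algZ (linZ lchi).
rewrite horner_sum (big_rem s) //= hornerZ lE // eqxx mulr1 big_seq big1 ?addr0 //.
move=> t; rewrite mem_rem_uniq // => /andP[nts tr].
by rewrite hornerZ lE // eq_sym (negPf nts) mulr0.
Qed.

(** All eigenvalues t of a satisfy t ^+ m = mu, so they have the same modulus as
    nu, and the conjugate of t is t^-1 up to the factor |nu|^2; the multiplicities
    are natural numbers, so the same holds for the traces. *)
Lemma scalar_power_trace m (mu nu : F) a b :
    (0 < m)%N -> mu != 0 -> nu ^+ m = mu -> a ^+ m = mu%:A -> a * b = 1 ->
  (chi a)^* = `|nu| ^+ 2 * chi b.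
Proof.
move=> m0 mu0 num am ab.
pose P : {poly F} := 'X^m - mu%:P.
have [rs] := closed_field_poly_normal P.
have -> : lead_coef P = 1 by rewrite /P lead_coefDl ?lead_coefXn // size_polyXn size_opp size_polyC mu0 ltnS.
rewrite scale1r => PE.
have rP t : t \in rs -> t ^+ m = mu.
  rewrite -root_prod_XsubC -PE rootE /P !hornerE subr_eq0.
  by move/eqP.
have urs : uniq rs.
  rewrite -separable_prod_XsubC -PE unlock; apply/Bezout_eq1_coprimepP.
  exists (- (mu^-1)%:P, (mu^-1 / m%:R)%:P * 'X) => /=.
  rewrite /P derivB derivXn derivC subr0 mulNr -['X^(m.-1) *+ m]mulr_natl.
  rewrite (_ : _ * (_ * 'X^(m.-1)) = (mu^-1 / m%:R)%:P * m%:R * ('X * 'X^(m.-1))); last by ring.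
  rewrite -exprS prednK // -polyC_natr -rmorphM /= divfK ?pnatr_eq0 -?lt0n //.
  by rewrite mulrBr -rmorphM mulVf //= opprB subrK.
have [n nE] : exists n : F -> nat, forall q, chi (horner_alg a q) = \sum_(t <- rs) q.[t] * (n t)%:R.
  apply: spectral_trace => //; rewrite -PE rmorphB /= rmorphXn /= horner_algX am.
  by rewrite horner_algC subrr.
have -> : b = horner_alg a (mu^-1 *: 'X^(m.-1)).
  rewrite horner_algZ rmorphXn /= horner_algX -[LHS]mul1r.
  have -> : 1 = mu^-1 *: (a ^+ m.-1 * a) by rewrite -exprSr prednK // am scalerA mulVf ?scale1r.
  by rewrite -scalerAl -mulrA ab mulr1.
rewrite -{1}[a]horner_algX !nE rmorph_sum mulr_sumr big_seq [RHS]big_seq.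
apply: eq_bigr => t tr; rewrite rmorphM /= conjC_nat mulrA; congr (_ * _).
rewrite hornerX hornerZ hornerXn.
have t0 : t != 0 by apply: contraNneq mu0 => t0; rewrite -(rP t tr) t0 expr0n eqn0Ngt m0.
have -> : `|nu| = `|t|.
  by apply/eqP; rewrite -(eqrXn2 m0) ?normr_ge0 // -!normrX num rP.
have t'0 : t ^+ m.-1 != 0 by rewrite expf_neq0.
rewrite normCKC -(rP t tr) -[m in (t ^+ m)^-1]prednK // exprS invfM.
by rewrite -!mulrA mulVf // mulr1 divff ?mulr1.
Qed.

End TraceRank.

(** * Central idempotents and positivity of the trace of a conjugation *)

Section Riesz.
Variables (F : fieldType) (A : falgType F).
Local Notation chi := (@regchar F A).
Let lchi := @lin_regchar F A.

(** The Gram matrix of a basis of K is invertible. *)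
Lemma regchar_riesz (K : {vspace A}) :
    (forall z, z \in K -> (forall x, x \in K -> chi (x * z) = 0) -> z = 0) ->
  forall D : A -> F, linF D ->
  exists2 z, z \in K & forall x, x \in K -> D x = chi (x * z).
Proof.
move=> nd D lD; pose e := vbasis K; pose N := \dim K.
pose G : 'M[F]_N := \matrix_(i, j) chi (e`_i * e`_j).
have eE x : x \in K -> x = \sum_i coord e i x *: e`_i by exact: coord_vbasis.
have eK (i : 'I_N) : e`_i \in K by apply: vbasis_mem; rewrite mem_nth ?size_tuple.
have sK (c : 'I_N -> F) : \sum_i c i *: e`_i \in K.
  by apply: rpred_sum => i _; apply: rpredZ; exact: eK.
have GE (c : 'cV[F]_N) i : (G *m c) i 0 = chi (e`_i * \sum_j c j 0 *: e`_j).
  rewrite mxE mulr_sumr (lin_sum lchi); apply: eq_bigr => j _.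
  by rewrite mxE -scalerAr (linZ lchi) mulrC.
have Gu : G \in unitmx.
  rewrite -unitmx_tr -row_free_unit -kermx_eq0; apply/rowV0P => v /sub_kermxP vG.
  have Gv : G *m v^T = 0 by apply: trmx_inj; rewrite trmx_mul trmxK vG trmx0.
  have : \sum_j v^T j 0 *: e`_j = 0.
    apply: nd (sK _) _ => x xK; rewrite (eE x xK) mulr_suml (lin_sum lchi) big1 // => i _.
    by rewrite -scalerAl (linZ lchi) -GE Gv mxE scaler0.
  move=> v0; apply/rowP => j; rewrite mxE.
  have := congr1 (coord e j) v0; rewrite coord_sum_free ?(basis_free (vbasisP _)) //.
  by rewrite linear0 mxE.
pose c := invmx G *m \col_i D e`_i.
exists (\sum_j c j 0 *: e`_j); first exact: sK.
move=> x xK; rewrite (eE x xK) mulr_suml (lin_sum lD) (lin_sum lchi).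
by apply: eq_bigr => i _; rewrite -scalerAl (linZ lchi) (linZ lD) -GE mulKVmx // mxE.
Qed.

End Riesz.

Section CentralIdempotents.
Variables (F : numClosedFieldType) (A : falgType F).
Implicit Types (x y z e f g : A) (p q : {poly F}).
Local Notation chi := (@regchar F A).
Let lchi := @lin_regchar F A.
Hypothesis regchar_nondeg : forall z, (forall x, chi (x * z) = 0) -> z = 0.

Definition central z := forall x, x * z = z * x.

Lemma centralM z z' : central z -> central z' -> central (z * z').
Proof. by move=> cz cz' x; rewrite mulrA cz -mulrA cz' mulrA. Qed.

Lemma centralD z z' : central z -> central z' -> central (z + z').
Proof. by move=> cz cz' x; rewrite mulrDr mulrDl cz cz'. Qed.

Lemma centralN z : central z -> central (- z).
Proof. by move=> cz x; rewrite mulrN mulNr cz. Qed.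

Lemma centralZ (k : F) z : central z -> central (k *: z).
Proof. by move=> cz x; rewrite -scalerAl -scalerAr cz. Qed.

Lemma central_horner z p : central z -> central (horner_alg z p).
Proof.
move=> cz x; rewrite horner_algE mulr_sumr mulr_suml; apply: eq_bigr => i _.
rewrite -scalerAl -scalerAr; congr (_ *: _).
elim: (i : nat) => [|k IHk]; first by rewrite mul1r mulr1.
by rewrite exprS mulrA cz -mulrA IHk mulrA.
Qed.

(** If h is central with h^2 = 0, then (x h)^2 = 0, whence chi(x h) = 0. *)
Lemma central_reduced h : central h -> h * h = 0 -> h = 0.
Proof.
move=> ch hh; apply: regchar_nondeg => x.
apply: regchar_sq0.
by rewrite -mulrA [h * _]mulrA -ch -mulrA hh !mulr0.
Qed.

(** Let p = q (X - t) be of least degree with p(z) f = 0.  Then q(t) != 0, since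
    otherwise q(z) f, nonzero by minimality, would be central with square 0; and
    multiplication by q(z) f / q(t) projects onto the eigenspace of z for t. *)
Lemma central_split f z : central f -> f * f = f -> f != 0 -> central z ->
    (forall t : F, z * f != t *: f) ->
  exists g, [/\ central g, g * g = g, g * f = g, g != 0 & g != f].
Proof.
move=> cf ff nf cz nz.
pose ann n := `[< exists p, [/\ p != 0, size p = n & horner_alg z p * f = 0] >].
have exn : exists n, ann n.
  have [p np pz] := annihilator z; exists (size p); apply/asboolP; exists p.
  by rewrite pz mul0r.
have [n /asboolP[p [np szp pzf]] minn] := ex_minnP exn.
have [t pt] : exists t, root p t.
  apply/closed_rootP; apply: contra_neq nf => /eqP/size_poly1P[c nc pc].
  have := pzf; rewrite pc horner_algC -scalerAl mul1r => /eqP.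
  by rewrite scaler_eq0 (negPf nc) => /eqP.
have /factor_theorem[q pq] := pt.
have nq : q != 0 by apply: contraNneq np => q0; rewrite pq q0 mul0r.
have szq : size p = (size q).+1 by rewrite pq size_Mmonic ?monicXsubC // size_XsubC addn2.
have qzf : horner_alg z q * f != 0.
  apply/eqP => qz0; have /minn : ann (size q) by apply/asboolP; exists q.
  by rewrite -szp szq ltnn.
have hX s : horner_alg z ('X - s%:P) = z - s%:A.
  by rewrite rmorphB /= horner_algX horner_algC.
have qt : q.[t] != 0.
  apply/eqP => /eqP qt0; case/eqP: qzf.
  apply: central_reduced; first by apply: centralM => //; apply: central_horner.
  have /factor_theorem[r qr] : root q t by [].
  rewrite -mulrA (mulrA f) -(cf (horner_alg z q)) -(mulrA _ f f) ff mulrA -rmorphM.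
  rewrite (_ : q * q = r * p); last by rewrite pq {1}qr; ring.
  by rewrite rmorphM -mulrA pzf mulr0.
pose g := (q.[t])^-1 *: (horner_alg z q * f).
have cg : central g by apply: centralZ; apply: centralM => //; apply: central_horner.
have gf : g * f = g by rewrite /g -scalerAl -mulrA ff.
have zg : z * g = t *: g.
  have : (z - t%:A) * g = 0.
    rewrite -hX /g -scalerAr mulrA -rmorphM mulrC -pq pzf scaler0 //.
  by rewrite mulrBl => /subr0_eq ->; rewrite -scalerAl mul1r.
have pg s : horner_alg z s * g = s.[t] *: g.
  have zk k : z ^+ k * g = t ^+ k *: g.
    elim: k => [|k IHk]; first by rewrite mul1r scale1r.
    by rewrite exprSr -mulrA zg -scalerAr IHk scalerA exprS.
  rewrite horner_algE horner_coef mulr_suml scaler_suml; apply: eq_bigr => i _.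
  by rewrite -scalerAl zk scalerA.
exists g; split => //.
- by rewrite {1}/g -scalerAl -mulrA -[f * g]cf gf pg scalerA mulVf ?scale1r.
- by rewrite scaler_eq0 invr_eq0 (negPf qt).
- by apply: contra_neq (nz t) => gE; rewrite -gE -zg gE.
Qed.

Lemma riesz (D : A -> F) : linF D -> exists z, forall x, D x = chi (x * z).
Proof.
move=> lD; have [z _ zD] := @regchar_riesz F A {:A} (fun z _ nd =>
  regchar_nondeg (fun x => nd x (memvf x))) D lD.
by exists z => x; apply: zD; exact: memvf.
Qed.

(** By duality D is chi(- z), and z is central because D is a trace; as the
    centre is scalar on the block cut out by f, z acts there as a scalar. *)
Lemma trace_form_unique f (D : A -> F) : central f -> f * f = f -> f != 0 ->
    (forall z, central z -> exists t : F, z * f = t *: f) ->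
    linF D -> (forall x y, D (x * y) = D (y * x)) -> (forall x, D (x * f) = D x) ->
  forall x, chi f * D x = D 1 * chi (x * f).
Proof.
move=> cf ff nf prim lD DC Df x.
have [z Dz] := riesz lD.
have cz : central z.
  move=> y; apply/eqP; rewrite -subr_eq0; apply/eqP/regchar_nondeg => u.
  have E1 : chi (u * (y * z)) = D (u * y) by rewrite Dz mulrA.
  have E2 : chi (u * (z * y)) = D (u * y) by rewrite mulrA regcharC mulrA -Dz DC.
  by rewrite mulrBr -scaleN1r addrC lchi E1 E2 scaleN1r addNr.
have [t zf] := prim z cz.
have DE y : D y = t * chi (y * f).
  by rewrite -Df Dz -mulrA -cf zf -scalerAr (linZ lchi).
by rewrite !DE mul1r; ring.
Qed.

(** By induction on the rank of f, it suffices to treat an f on which the centre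
    acts by scalars.  There [trace_form_unique], used on both sides, gives
    chi(f) tr(x -> f a x b) = chi(a f) chi(b f).  Since w ^+ m is a scalar on this
    block, chi(wi f) is the conjugate of chi(w f) up to a positive factor, by
    [scalar_power_trace]. *)
Lemma conj_trace_ge0 (w wi : A) m f : w * wi = 1 -> wi * w = 1 -> (0 < m)%N ->
    central (w ^+ m) -> central f -> f * f = f ->
  0 <= endo_tr (fun x => f * (w * x * wi)).
Proof.
move=> wwi wiw m0 cwm; have [n] := ubnP (mulrank f); elim: n f => // n IHn f.
rewrite ltnS => rkf cf ff.
have [-> | nf] := eqVneq f 0.
  rewrite (_ : (fun _ => _) = fun x : A => 0 : A); last by apply/funext => x; rewrite mul0r.
  by rewrite /endo_tr big1 // => i _; rewrite linear0.
have ltrk0 g : g != 0 -> (0 < mulrank g)%N.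
  by rewrite lt0n; apply: contra_neq => /mulrank0.
have [prim | /existsNP[z /not_implyP[cz /forallNP nz]]] :=
  pselect (forall z, central z -> exists t : F, z * f = t *: f); last first.
  have [|g [cg gg gf ng nfg]] := central_split cf ff nf cz.
    by move=> t; apply/eqP => zf; apply: (nz t).
  have fg : f * g = g by rewrite cg.
  pose h := f - g.
  have ch : central h by apply: centralD => //; apply: centralN.
  have hh : h * h = h by rewrite /h mulrBl !mulrBr ff fg gf gg subrr subr0.
  have nh : h != 0 by rewrite subr_eq0 eq_sym.
  have rk : (mulrank f = mulrank g + mulrank h)%N.
    apply/eqP; rewrite -(eqr_nat F) natrD -!regchar_idem // -(linD lchi).
    by rewrite /h addrC subrK.
  rewrite (_ : (fun _ => _) =
      fun x => g * (w * x * wi) + h * (w * x * wi)); last first.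
    by apply/funext => x; rewrite -mulrDl /h addrC subrK.
  rewrite endo_trD addr_ge0 //; apply: IHn => //; apply: leq_trans rkf; rewrite rk.
    by rewrite -[X in (X < _)%N]addn0 ltn_add2l ltrk0.
  by rewrite -[X in (X < _)%N]add0n ltn_add2r ltrk0.
have chif : 0 < chi f by rewrite regchar_idem // ltr0n ltrk0.
have lmul (u v : A) : lin (fun x => u * x * v) by lint.
have fM (u v : A) : f * (u * v) = u * (f * v) by rewrite mulrA -cf mulrA.
pose m2 a b := endo_tr (fun x => f * (a * x * b)).
have m2l b x : chi f * m2 x b = m2 1 b * chi (x * f).
  apply: (trace_form_unique (D := fun a => m2 a b)) => //.
  - move=> k u v; suff E : m2 (k *: u + v) b = k * m2 u b + m2 v b by exact: E.
    rewrite /m2 -endo_trP; apply: eq_endo_tr => y.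
    by rewrite 2!mulrDl mulrDr -!scalerAl -scalerAr.
  - move=> u v; rewrite /m2.
    transitivity (endo_tr (fun y => u * (f * (v * y * b)))).
      by apply: eq_endo_tr => y; rewrite -!mulrA fM.
    rewrite endo_tr_cyc; [|lint|lint].
    by apply: eq_endo_tr => y; rewrite -!mulrA.
  - by move=> u; apply: eq_endo_tr => y; rewrite -!mulrA fM (mulrA f f) ff -fM.
have m2r x : chi f * m2 1 x = m2 1 1 * chi (x * f).
  apply: (trace_form_unique (D := fun b => m2 1 b)) => //.
  - move=> k u v; suff E : m2 1 (k *: u + v) = k * m2 1 u + m2 1 v by exact: E.
    rewrite /m2 -endo_trP; apply: eq_endo_tr => y.
    by rewrite !mulrDr -!scalerAr.
  - move=> u v; rewrite /m2.
    transitivity (endo_tr (fun y => (f * (1 * y * u)) * v)).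
      by apply: eq_endo_tr => y; rewrite -!mulrA.
    rewrite (@endo_tr_cyc _ _ (fun y => y * v)); [|lint|lint].
    by apply: eq_endo_tr => y; rewrite -!mulrA.
  - by move=> u; apply: eq_endo_tr => y; rewrite (cf u) fM (mulrA f f) ff -fM.
have m11 : m2 1 1 = chi f by apply: eq_endo_tr => y; rewrite mul1r mulr1.
have m2E : chi f * m2 w wi = chi (w * f) * chi (wi * f).
  rewrite m2l mulrC; congr (_ * _); apply: (mulfI (lt0r_neq0 chif)).
  by rewrite m2r m11.
have [mu wmf] := prim _ cwm.
have wiX k : wi ^+ k * w ^+ k = 1.
  elim: k => [|k IHk]; first by rewrite mulr1.
  by rewrite exprSr exprS mulrA -(mulrA (wi ^+ k)) wiw mulr1.
have mu0 : mu != 0.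
  apply: contraNneq nf => mu0; rewrite -[f]mul1r -(wiX m) -mulrA wmf mu0.
  by rewrite scale0r mulr0.
pose nu := m.-root mu.
have num : nu ^+ m = mu by exact: rootCK.
have nu0 : nu != 0 by apply: contraNneq mu0 => nu0; rewrite -num nu0 expr0n eqn0Ngt m0.
pose h := 1 - f.
have fh : f * h = 0 by rewrite mulrBr mulr1 ff subrr.
have hf : h * f = 0 by rewrite mulrBl mul1r ff subrr.
have hh : h * h = h by rewrite {1}/h mulrBl mul1r fh subr0.
have ch : central h by move=> x; rewrite mulrBr mulrBl mulr1 mul1r cf.
(* [scalar_power_trace] concerns elements of A whose power is a scalar on the
   whole of A, so w is replaced outside of the block by a root of the scalar. *)
pose a := w * f + nu *: h; pose b := wi * f + nu^-1 *: h.
have ffM (u v : A) : (u * f) * (v * f) = u * v * f.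
  by rewrite -mulrA (mulrA f) -cf -(mulrA v) ff mulrA.
have fhM (u : A) : (u * f) * h = 0 by rewrite -mulrA fh mulr0.
have hfM (u : A) : h * (u * f) = 0 by rewrite mulrA -ch -mulrA hf mulr0.
have abM (u v : A) (k l : F) :
    (u * f + k *: h) * (v * f + l *: h) = u * v * f + (k * l) *: h.
  rewrite mulrDl !mulrDr -!scalerAl -!scalerAr ffM fhM hfM hh !scaler0.
  by rewrite addr0 add0r scalerA.
have ab : a * b = 1.
  by rewrite /a /b abM wwi mul1r divff // scale1r /h addrC subrK.
have aX k : a ^+ k.+1 = w ^+ k.+1 * f + nu ^+ k.+1 *: h.
  by elim: k => [|k IHk]; [rewrite !expr1 | rewrite exprS IHk abM -!exprS].
have am : a ^+ m = mu%:A.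
  by rewrite -(prednK m0) aX prednK // wmf num -scalerDr /h addrC subrK.
have := scalar_power_trace m0 mu0 num am ab.
have chih : (chi h)^* = chi h by rewrite regchar_idem // conjC_nat.
rewrite /a /b !(linD lchi) !(linZ lchi) rmorphD /= rmorphM /= chih mulrDr.
rewrite normCKC.
have -> : nu^* * nu * (nu^-1 *: (chi h : F^o)) = nu^* * chi h.
  by rewrite -[_ *: _]/(_ * _) -mulrA mulVKf.
move/addIr => cw.
rewrite -(pmulr_rge0 _ chif) -/(m2 w wi) m2E.
have nn : 0 < nu^* * nu by rewrite -normCKC exprn_gt0 ?normr_gt0.
rewrite -(pmulr_rge0 _ nn) mulrCA -cw.
exact: mul_conjC_ge0.
Qed.

End CentralIdempotents.

(** * The convolution square of the regular character *)

Section TensorTrace.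
Variables (F : fieldType) (U V : vectType F).
Implicit Types (t : tensor U V).

Lemma tens_sum t :
  t = \sum_i \sum_j t i j *: tens (vbasis {:U})`_i (vbasis {:V})`_j.
Proof.
apply: (tens_ext (f := idfun) (g := tlift (@tens F U V))) => u v.
rewrite /= tlift_tens // => [w|w]; first by apply: lin_tensl.
by apply: lin_tensr.
Qed.

Lemma mlift_eta (W : lmodType F) (f : tensor U V -> W) : lin f ->
  f =1 mlift (fun u v => f (tens u v)).
Proof.
move=> lf t; rewrite {1}[t]tens_sum (lin_sum lf); apply: eq_bigr => i _.
by rewrite (lin_sum lf); apply: eq_bigr => j _; rewrite (linZ lf).
Qed.

Lemma lin_tens_ext (W : lmodType F) (f g : tensor U V -> W) : lin f -> lin g ->
  (forall u v, f (tens u v) = g (tens u v)) -> f =1 g.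
Proof.
by move=> lf lg fg t; rewrite (mlift_eta lf) (mlift_eta lg); apply: eq_mlift.
Qed.

Lemma endo_tr_tens (P : U -> U) (Q : V -> V) :
  endo_tr (mlift (fun u v => tens (P u) (Q v))) = endo_tr P * endo_tr Q.
Proof.
pose e := vbasis {:U}; pose e' := vbasis {:V}.
pose E i j (t : tensor U V) : tensor U V := t i j *: tens (P e`_i) (Q e'`_j).
have := @endo_tr_sum F (tensor U V) _ (index_enum _) (fun i t => \sum_j E i j t).
move=> E1; apply: (etrans E1); rewrite /endo_tr mulr_suml; apply: eq_bigr => i _.
have := @endo_tr_sum F (tensor U V) _ (index_enum _) (E i).
move=> E2; apply: (etrans E2); rewrite mulr_sumr; apply: eq_bigr => j _.
rewrite /E (@endo_tr_rank1 _ (tensor U V) (fun t : tensor U V => t i j)) ?mxE //.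
by move=> a s t; rewrite !mxE.
Qed.

End TensorTrace.

Section RegularCharacter.
Variables (F : fieldType) (H : hopfType F).
Implicit Types (x y h : H).
Local Notation S := (@antipode F H).
Local Notation eps := (@counit F H).
Local Notation chi := (@regchar F H).

(** The action of h_1 (x) h_2 on H (x) H is conjugate to that of h (x) 1 by the
    invertible map W : x (x) y -> x_1 (x) x_2 y.  The right-hand side is the trace
    of the latter. *)
Lemma regchar_conv h :
  @sw F H F^o (fun a c => chi a * chi c) h = (\dim {:H})%:R * chi h.
Proof.
pose W : tensor H H -> tensor H H := mlift (fun x y => sw (fun a c => tens a (c * y)) x).
pose Wi : tensor H H -> tensor H H := mlift (fun x y => sw (fun a c => tens a (S c * y)) x).
pose L : tensor H H -> tensor H H := mlift (fun x y => tens (h * x) y).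
pose M (t : tensor H H) : tensor H H :=
  sw (fun a c => mlift (fun x y => tens (a * x) (c * y)) t) h.
have lW : lin W by exact: lin_mlift.
have lWi : lin Wi by exact: lin_mlift.
have lL : lin L by exact: lin_mlift.
have lM : lin M by apply: lin_sw_in => a c; exact: lin_mlift.
have WE x y : W (tens x y) = sw (fun a c => tens a (c * y)) x.
  by rewrite /W mlift_tens //; lint.
have WiE x y : Wi (tens x y) = sw (fun a c => tens a (S c * y)) x.
  by rewrite /Wi mlift_tens //; lint.
have LE x y : L (tens x y) = tens (h * x) y by rewrite /L mlift_tens //; lint.
have ME x y : M (tens x y) = sw (fun a c => tens (a * x) (c * y)) h.
  by apply: eq_sw => a c; rewrite mlift_tens //; lint.
have WWi : W \o Wi =1 id.
  apply: (lin_tens_ext (lin_comp lW lWi) (@lin_id _ _)) => x y /=.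
  rewrite WiE (sw_lin _ _ lW).
  transitivity (sw (fun a c => sw (fun u v => tens u (v * (S c * y))) a) x).
    by apply: eq_sw => a c; rewrite WE.
  rewrite (@swA F H _ (fun u v c => tens u (v * (S c * y)))); try lint.
  rewrite -(@sw_eps_r F H _ (fun u => tens u y)); last by lint.
  apply: eq_sw => u r; have := @sw_Sr F H _ (fun z => tens u (z * y)) r ltac:(lint).
  by rewrite mul1r => <-; apply: eq_sw => v c; rewrite mulrA.
have WiW : Wi \o W =1 id.
  apply: (lin_tens_ext (lin_comp lWi lW) (@lin_id _ _)) => x y /=.
  rewrite WE (sw_lin _ _ lWi).
  transitivity (sw (fun a c => sw (fun u v => tens u (S v * (c * y))) a) x).
    by apply: eq_sw => a c; rewrite WiE.
  rewrite (@swA F H _ (fun u v c => tens u (S v * (c * y)))); try lint.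
  rewrite -(@sw_eps_r F H _ (fun u => tens u y)); last by lint.
  apply: eq_sw => u r; have := @sw_Sl F H _ (fun z => tens u (z * y)) r ltac:(lint).
  by rewrite mul1r => <-; apply: eq_sw => v c; rewrite mulrA.
have MW : M \o W =1 W \o L.
  apply: (lin_tens_ext (lin_comp lM lW) (lin_comp lW lL)) => x y /=.
  rewrite LE !WE (sw_lin _ _ lM) swM; try lint.
  rewrite sw_exch; apply: eq_sw => u v; rewrite ME.
  by apply: eq_sw => a c; rewrite mulrA.
suff trM : endo_tr M = (\dim {:H})%:R * chi h.
  apply: etrans trM; symmetry.
  rewrite /M /sw endo_tr_sum; apply: eq_bigr => i _; rewrite endo_tr_sum; apply: eq_bigr => j _.
  by rewrite endo_trZ endo_tr_tens.
transitivity (endo_tr (fun t => W ((fun t => L (Wi t)) t))).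
  by apply: eq_endo_tr => t; rewrite -[in LHS](WWi t) -[M _]/((M \o W) (Wi t)) MW.
rewrite endo_tr_cyc //; last exact: lin_comp.
transitivity (endo_tr L).
  by apply: eq_endo_tr => t; rewrite /= -[Wi (W t)]/((Wi \o W) t) WiW.
by rewrite /L (@endo_tr_tens _ H H (fun x => h * x) id) endo_tr_id mulrC.
Qed.

End RegularCharacter.

(** * The Larson-Radford theorem *)

Section LarsonRadford.
Variables (F : numClosedFieldType) (H : hopfType F).
Implicit Types (x y h : H).
Local Notation S := (@antipode F H).
Local Notation eps := (@counit F H).
Local Notation Si := (@antipode_inv F H).
Local Notation chi := (@regchar F H).
Local Notation N := (\dim {:H}).
Variable T : H.
Hypothesis Tl : forall x, x * T = eps x *: T.
Hypothesis epsT : eps T = 1.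
Let lchi := @lin_regchar F H.

(** The radical I of the trace form is a left ideal.  Averaging a projection
    onto I with T makes it H-linear, that is, right multiplication by some
    idempotent e of I; e has trace 0, so e = 0 and I = 0. *)
Lemma regchar_nondeg z : (forall x, chi (x * z) = 0) -> z = 0.
Proof.
pose e := vbasis {:H}.
pose phi (z : H) : H := \sum_(i < N) chi (e`_i * z) *: e`_i.
have lphi : lin phi.
  by apply: lin_bigsum => i; apply: lin_scalel; apply: (lin_comp lchi); lint.
pose lphi' := GRing.isLinear.Build F H H _ _ (linE lphi).
pose phi0 : {linear H -> H} := HB.pack phi lphi'.
pose I := lker (linfun phi0).
have inI u : (u \in I) <-> (forall x, chi (x * u) = 0).
  rewrite memv_ker lfunE -[_ u]/(phi u) /phi; split=> [/eqP u0 x|u0]; last first.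
    by apply/eqP; rewrite big1 // => i _; rewrite u0 scale0r.
  rewrite [x](coord_vbasis (memvf x)) mulr_suml (lin_sum lchi) big1 // => i _.
  rewrite -scalerAl (linZ lchi); have := congr1 (coord e i) u0.
  rewrite linear0 (coord_sum_free (fun j => chi (e`_j * u))) ?(basis_free (vbasisP _)) // => ->.
  exact: scaler0.
have Imul x u : u \in I -> x * u \in I.
  by move=> /inI u0; apply/inI => y; rewrite mulrA u0.
(* Maschke's average of the projection onto I. *)
pose pi x := sw (fun a c => S a * projv I (c * x)) T.
have piI x : pi x \in I.
  rewrite /pi /sw; apply: rpred_sum => i _; apply: rpred_sum => j _.
  by apply: rpredZ; apply: Imul; exact: memv_proj.
have lpr : lin (projv I) by exact: lin_linear.
have piM h x : pi (h * x) = h * pi x.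
  rewrite /pi (@sw_lin F H H H (fun z => h * z)); last by lint.
  rewrite -{2}[h](antipode_invK Tl epsT).
  transitivity (sw (fun a c => S (a * Si h) * projv I (c * x)) T); last first.
    by apply: eq_sw => a c; rewrite antipodeM mulrA.
  rewrite (@int_swapr F H T Tl epsT H (fun a c => S a * projv I (c * x))); try lint.
  by apply: eq_sw => a c; rewrite (antipode_invK Tl epsT) mulrA.
have pi_id u : u \in I -> pi u = u.
  move=> uI; transitivity (sw (fun a c => S a * c * u) T).
    by apply: eq_sw => a c; rewrite projv_id ?mulrA //; exact: Imul.
  by rewrite (@sw_Sl F H H (fun z => z * u)) ?mul1r ?epsT ?scale1r //; lint.
move=> /inI zI; pose e1 := pi 1.
have e1I u : u \in I -> u * e1 = u by move=> /pi_id; rewrite -{1}[u]mulr1 piM.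
have e10 : e1 = 0.
  apply: mulrank0; apply/eqP; rewrite -(pnatr_eq0 F) -regchar_idem; last exact/e1I/piI.
  by have /inI/(_ 1) := piI 1; rewrite mul1r => ->.
by rewrite -(e1I _ zI) e10 mulr0.
Qed.

Lemma int_central : central T.
Proof. by move=> x; rewrite Tl (int_right Tl epsT). Qed.

Variable rho : H -> F.
Hypothesis lrho : linF rho.
Hypothesis rhoT : sw (fun a c => rho c *: a) T = 1.
Local Notation om := (omega T).

Lemma omega_unit : exists om', om' * om = 1 /\ om * om' = 1.
Proof.
have inj z : z * om = 0 -> z = 0.
  move=> zo; apply: regchar_nondeg => x.
  by rewrite (regchar_rho Tl epsT lrho rhoT) -mulrA zo mulr0 (lin0 lrho).
have kR : lker (amulr om) == 0%VS.
  apply/lker0P => x y; rewrite !lfunE /= => xy; apply/subr0_eq/inj.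
  by rewrite mulrBl xy subrr.
pose om' : H := ((amulr om)^-1)%VF 1.
have o1 : om' * om = 1 by have := lker0_lfunVK kR 1; rewrite lfunE.
exists om'; split=> //; apply/subr0_eq/inj.
by rewrite mulrBl mul1r -mulrA o1 mulr1 subrr.
Qed.

(** rho(1) is the trace of the inverse of S^2, which is the conjugation by
    omega.  Some power of omega is central, because S^4 is the conjugation by an
    element of finite order, so [conj_trace_ge0] bounds the trace from below by
    the contribution of the block of T, which is 1. *)
Lemma rho1_gt0 : 0 < rho 1.
Proof.
have [om' [o1 o2]] := omega_unit.
have gg := modular_grouplike Tl epsT lrho rhoT.
have eg := counit_modular lrho rhoT.
have [k k0 gk] := grouplike_order gg (grouplike_Sl gg eg).
pose J x := S (S (S (S x))).
have Jom x : om * om * J x = x * (om * om).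
  rewrite /J -mulrA (omega_S2 Tl epsT lrho rhoT) mulrA.
  by rewrite (omega_S2 Tl epsT lrho rhoT) mulrA.
have iterJ p : (forall x, p * J x = x * p) -> forall i x, p ^+ i * iter i J x = x * p ^+ i.
  move=> pJ; elim=> [|i IHi] x; first by rewrite mul1r mulr1.
  by rewrite exprS iterSr -mulrA IHi mulrA pJ mulrA.
have JX := iterJ _ Jom.
have gX := iterJ _ (radford Tl epsT lrho rhoT).
have Jk x : iter k J x = x.
  by have := gX k x; rewrite gk mul1r mulr1.
have com : central (om ^+ (2 * k)).
  by move=> x; rewrite exprM expr2 -JX Jk.
have S2 x : Si (Si x) = om * x * om'.
  rewrite -[x in RHS](antipode_invK Tl epsT) -[Si x in RHS](antipode_invK Tl epsT).
  by rewrite (omega_S2 Tl epsT lrho rhoT) -mulrA o2 mulr1.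
have cT := int_central; have TT : T * T = T by rewrite Tl epsT scale1r.
have k2 : (0 < 2 * k)%N by rewrite muln_gt0.
have := conj_trace_ge0 regchar_nondeg o2 o1 k2 com.
move=> pos.
have -> : rho 1 = endo_tr (fun x => om * x * om').
  have := endo_tr_Si2_leg Tl epsT lrho rhoT (@lin_counit_id F H).
  rewrite epsT mulr1 => <-; apply: eq_endo_tr => x.
  by rewrite sw_eps_l -?S2 //.
have -> : endo_tr (fun x => om * x * om') =
    endo_tr (fun x => T * (om * x * om')) + endo_tr (fun x => (1 - T) * (om * x * om')).
  by rewrite -endo_trD; apply: eq_endo_tr => x; rewrite -mulrDl addrC subrK mul1r.
apply: ltr_wpDr.
  apply: pos; first by apply: centralD => //; [move=> x; rewrite mulr1 mul1r|apply: centralN].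
  by rewrite mulrBl mul1r mulrBr mulr1 TT subrr subr0.
rewrite (@eq_endo_tr _ _ _ (fun x => eps x *: T)) => [|x].
  by rewrite endo_tr_rank1 ?epsT //; exact: lin_counit_id.
rewrite (int_right Tl epsT) !counitM mulrAC -counitM o2 counit1 mul1r //.
Qed.

(** The defining relation of the distinguished grouplike at 1 reads
    rho(1) 1 = rho(1) g. *)
Lemma modular1 : modular T rho = 1.
Proof.
have := rho_modular Tl epsT lrho rhoT 1.
rewrite sw1; [|by lint|by lint].
by move/(scalerI (lt0r_neq0 rho1_gt0)).
Qed.

Lemma antipode4 x : S (S (S (S x))) = x.
Proof. by have := radford Tl epsT lrho rhoT x; rewrite modular1 mul1r mulr1. Qed.

(** J = S^2 is an involution, and P = N^-1 Q is an idempotent commuting with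
    it.  The traces of J and J P are rho(1) and rho(1) / N, and both are
    differences of ranks.  So rho(1) is N times a positive integer; being a
    difference of two ranks with sum N, it is N, and the eigenspace of J for -1
    vanishes. *)
Lemma antipode2 x : S (S x) = x.
Proof.
pose J x := S (S x).
have lJ : lin J by lint.
have JJ y : J (J y) = y by exact: antipode4.
have SiSi y : Si (Si y) = J y.
  by apply: (antipode_inj Tl epsT); apply: (antipode_inj Tl epsT); rewrite !(antipode_invK Tl epsT) -/(J (J y)) JJ.
have N0 : (N%:R : F) != 0.
  rewrite pnatr_eq0 dimv_eq0; apply: contraTneq (memvf (1 : H)) => ->.
  by rewrite memv0 oner_neq0.
pose Q h := sw (fun a c => chi a *: c) h.
have lQ : lin Q by exact: lin_sw.
have chiJ y : chi (J y) = chi y.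
  have SiJ u : J (J u) = u := JJ u.
  rewrite /regchar; transitivity (endo_tr (fun u => J (y * J u))).
    by apply: eq_endo_tr => u; rewrite /J !antipodeM !antipode4.
  rewrite endo_tr_cyc //; last by lint.
  by apply: eq_endo_tr => u; rewrite JJ.
have QJ y : Q (J y) = J (Q y).
  rewrite /Q {1}/J comul_antipode; [|lint|lint].
  rewrite comul_antipode; try by move=> *; lint.
  rewrite (sw_lin _ _ lJ); apply: eq_sw => a c.
  by rewrite (linZ lJ) -[S (S a)]/(J a) chiJ.
have QQ y : Q (Q y) = N%:R *: Q y.
  rewrite /Q (sw_lin _ _ (lin_sw _)).
  transitivity (sw (fun a c => sw (fun u v => (chi a * chi u) *: v) c) y).
    apply: eq_sw => a c; rewrite (linZ (lin_sw _)).
    rewrite (@sw_lin F H H H (fun z => chi a *: z)); last by lint.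
    by apply: eq_sw => u v; rewrite scalerA.
  rewrite -(@swA F H H (fun a u v => (chi a * chi u) *: v)); first last.
  - by lint.
  - by move=> u w; apply: lin_scalel; apply: lin_mulFr.
  - by move=> u w; apply: lin_scalel; apply: lin_mulFl.
  rewrite (@sw_lin F H H H (fun z => N%:R *: z)); last by lint.
  apply: eq_sw => p v; rewrite scalerA -regchar_conv.
  rewrite (@sw_lin F H F^o H (fun z => (z : F) *: v)) //.
  by apply: (@lin_scalel _ F^o H id v); exact: lin_id.
have chiT : chi T = 1 := regchar_int Tl epsT lrho rhoT.
have trJQ : endo_tr (fun y => J (Q y)) = rho 1.
  have := endo_tr_Si2_leg Tl epsT lrho rhoT lchi; rewrite chiT mulr1 => <-.
  by apply: eq_endo_tr => y; rewrite SiSi.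
have trJ : endo_tr J = rho 1 by exact: (endo_tr_S2 Tl epsT lrho rhoT).
(* For s = 1 and s = -1, the projections onto the eigenspaces of J. *)
pose E (s : F) y := 2^-1 *: (y + s *: J y).
pose P y := N%:R^-1 *: Q y.
have lE s : lin (E s) by rewrite /E; lint.
have lP : lin P by rewrite /P; lint.
have PP y : P (P y) = P y by rewrite /P (linZ lQ) QQ (scalerA _ N%:R) mulVf // scale1r.
have two0 : (2 : F) != 0 by rewrite pnatr_eq0.
have EE s y : s * s = 1 -> E s (E s y) = E s y.
  move=> ss; rewrite /E; set u := y + s *: J y.
  have Ju : s *: J u = u.
    by rewrite /u (linD lJ) (linZ lJ) JJ scalerDr scalerA ss scale1r addrC.
  rewrite (linZ lJ) scalerA mulrC -scalerA Ju -scalerDl.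
  by rewrite (_ : 2^-1 + 2^-1 = 1 :> F) ?scale1r //; field.
have PE s y : P (E s y) = E s (P y).
  rewrite /E /P (linZ lQ) (linD lQ) (linZ lQ) QJ (linZ lJ) !scalerA !scalerDr !scalerA.
  by congr (_ *: _ + _ *: _); ring.
have EPEP s y : s * s = 1 -> E s (P (E s (P y))) = E s (P y).
  by move=> ss; rewrite PE PP EE.
have trE s Z : endo_tr (fun y => E s (Z y)) = 2^-1 * (endo_tr Z + s * endo_tr (fun y => J (Z y))).
  by rewrite /E endo_trZ endo_trD endo_trZ.
have s1 : 1 * 1 = 1 :> F by rewrite mulr1.
have sm1 : (-1) * (-1) = 1 :> F by rewrite mulrNN mulr1.
pose r s := \rank (endo_mx (E s)); pose q s := \rank (endo_mx (fun y => E s (P y))).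
have rE s : s * s = 1 -> (r s)%:R = 2^-1 * (N%:R + s * rho 1).
  move=> ss; rewrite -(endo_tr_idem (lE s)) => [|y]; last exact: EE.
  by rewrite -trJ -(endo_tr_id H) -(trE s id).
have trJP : endo_tr (fun y => J (P y)) = N%:R^-1 * rho 1.
  by rewrite -trJQ -endo_trZ; apply: eq_endo_tr => y; rewrite /P (linZ lJ).
have qE s : s * s = 1 -> (q s)%:R = 2^-1 * (endo_tr P + s * (N%:R^-1 * rho 1)).
  move=> ss; rewrite -endo_tr_idem; first by rewrite trE trJP.
    exact: (lin_comp (lE s) lP).
  by move=> y; exact: EPEP.
pose r1 := r 1; pose rm := r (-1); pose q1 := q 1; pose qm := q (-1).
have r1E : r1%:R = 2^-1 * (N%:R + 1 * rho 1) by exact: rE.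
have rmE : rm%:R = 2^-1 * (N%:R + (-1) * rho 1) by exact: rE.
have q1E : q1%:R = 2^-1 * (endo_tr P + 1 * (N%:R^-1 * rho 1)) by exact: qE.
have qmE : qm%:R = 2^-1 * (endo_tr P + (-1) * (N%:R^-1 * rho 1)) by exact: qE.
have sum_r : (r1 + rm = N)%N.
  by apply/eqP; rewrite -(eqr_nat F) natrD r1E rmE; apply/eqP; field.
have diff_r : r1%:R = rm%:R + rho 1 by rewrite r1E rmE; field.
have diff_rq : (N * q1 + rm = N * qm + r1)%N.
  by apply/eqP; rewrite -(eqr_nat F) !natrD !natrM r1E rmE q1E qmE; apply/eqP; field.
have lt_r : (rm < r1)%N by rewrite -(ltr_nat F) diff_r ltrDl rho1_gt0.
have r0 : rm = 0%N.
  have lt_q : (qm < q1)%N by rewrite -(ltn_pmul2l (m := N)) //; lia.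
  have : (N * qm.+1 <= N * q1)%N by rewrite leq_mul2l lt_q orbT.
  rewrite mulnS; lia.
have := endo_mx_rank0 (lE (-1)) r0 x; rewrite /E scaleN1r => /eqP.
by rewrite scaler_eq0 invr_eq0 (negPf two0) subr_eq0 => /eqP.
Qed.

Lemma omega1 : om = 1.
Proof.
transitivity (sw (fun a c => S a * c) T).
  apply: eq_sw => a c; congr (_ * _); apply: (antipode_inj Tl epsT).
  by rewrite (antipode_invK Tl epsT) antipode2.
by rewrite (@sw_Sl F H H id) ?epsT ?scale1r //; lint.
Qed.

Lemma regchar_eq_rho x : chi x = rho x.
Proof. by rewrite (regchar_rho Tl epsT lrho rhoT) omega1 mulr1. Qed.

End LarsonRadford.

(** The Larson-Radford theorem: the regular character of a semisimple Hopf
    algebra in characteristic 0 is an integral. *)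
Theorem regchar_integral (F : numClosedFieldType) (H : hopfType F) : semisimple H ->
  forall x : H, sw (fun a c => regchar c *: a) x = regchar x *: 1.
Proof.
move=> /semisimple_integral[T Tl epsT] x.
have [rho lrho rhoT] := int_legr_surj Tl epsT 1.
rewrite (regchar_eq_rho Tl epsT lrho rhoT) -(rho_int Tl epsT lrho rhoT).
by apply: eq_sw => a c; rewrite (regchar_eq_rho Tl epsT lrho rhoT).
Qed.

(** * Left coideal subalgebras and their integrals *)

Lemma mlift_tensorv (F : fieldType) (U V W : vectType F) (b : U -> V -> W)
    (X : {vspace U}) (Y : {vspace V}) (Z : {vspace W}) s :
    (forall v, lin (fun u => b u v)) -> (forall u, lin (b u)) ->
    s \in tensorv X Y -> (forall x y, x \in X -> y \in Y -> b x y \in Z) ->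
  mlift b s \in Z.
Proof.
move=> b1 b2 sXY bZ; rewrite (coord_span (X := in_tuple _) sXY).
rewrite (lin_sum (lin_mlift b)); apply: rpred_sum => i _.
rewrite (linZ (lin_mlift b)); apply: rpredZ.
have /allpairsP[[x y] /= [xX yY ->]] :
    (in_tuple [seq tens x y | x <- vbasis X, y <- vbasis Y])`_i
      \in [seq tens x y | x <- vbasis X, y <- vbasis Y] by exact: mem_nth.
by rewrite mlift_tens //; apply: bZ; exact: vbasis_mem.
Qed.

Section CoidealSubalgebra.
Variables (F : numClosedFieldType) (H : hopfType F).
Implicit Types (x y h : H).
Local Notation S := (@antipode F H).
Local Notation eps := (@counit F H).
Local Notation chi := (@regchar F H).
Hypothesis ssH : semisimple H.
Let lchi := @lin_regchar F H.
Let leps := @lin_counit_id F H.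

Lemma antipode_involutive x : S (S x) = x.
Proof.
have [T Tl epsT] := semisimple_integral ssH.
have [rho lrho rhoT] := int_legr_surj Tl epsT 1.
exact: (antipode2 Tl epsT lrho rhoT).
Qed.

(** Both sides are obtained from S(y_1) y_2 x_1 chi(y_3 x_2). *)
Lemma regchar_strong_inv x y :
  sw (fun a c => chi (y * c) *: a) x = sw (fun a c => chi (c * x) *: S a) y.
Proof.
pose t p q1 q2 := sw (fun a c => chi (q2 * c) *: (S p * (q1 * a))) x.
transitivity (sw (fun p q => sw (t p) q) y).
  rewrite -(@swA F H H t); try by rewrite /t => *; lint.
  rewrite -(@sw_eps_l F H H (fun q => sw (fun a c => chi (q * c) *: a) x)); last first.
    by lint.
  apply: eq_sw => r q.
  have := @sw_Sl F H H (fun z => sw (fun a c => chi (q * c) *: (z * a)) x) r ltac:(lint).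
  under [X in _ = _ *: X]eq_sw => a c do rewrite mul1r.
  by move=> <-; apply: eq_sw => p q1; apply: eq_sw => a c; rewrite mulrA.
apply: eq_sw => p q.
transitivity (sw (fun u v => chi v *: (S p * u)) (q * x)); first by rewrite swM; try lint.
transitivity (S p * sw (fun u v => chi v *: u) (q * x)).
  rewrite (@sw_lin F H H H (fun z => S p * z)); last by lint.
  by apply: eq_sw => u v; rewrite scalerAr.
by rewrite (regchar_integral ssH) -scalerAr mulr1.
Qed.

Section OneSubalgebra.
Variable K : {vspace H}.
Hypothesis KK : left_coideal_subalgebra K.

Lemma coideal_unit : 1 \in K. Proof. by case: KK. Qed.

Lemma coidealM x y : x \in K -> y \in K -> x * y \in K.
Proof. by move=> xK yK; case: KK => _ /prodvP KM _; apply: KM. Qed.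

(** The second Sweedler component of an element of K may be taken in K. *)
Lemma coideal_sw (W : vectType F) (Z : {vspace W}) (b : H -> H -> W) x :
    (forall v, lin (fun u => b u v)) -> (forall u, lin (b u)) ->
    x \in K -> (forall a c, c \in K -> b a c \in Z) ->
  sw b x \in Z.
Proof.
move=> b1 b2 xK bZ; case: KK => _ _ /(_ x xK) xHK.
by apply: (mlift_tensorv b1 b2 xHK) => a c _; exact: bZ.
Qed.

Lemma eq_coideal_sw (W : vectType F) (b b' : H -> H -> W) x :
    (forall v, lin (fun u => b u v)) -> (forall u, lin (b u)) ->
    (forall v, lin (fun u => b' u v)) -> (forall u, lin (b' u)) ->
    x \in K -> (forall a c, c \in K -> b a c = b' a c) ->
  sw b x = sw b' x.
Proof.
move=> b1 b2 b1' b2' xK bb'; apply/eqP; rewrite -subr_eq0 -memv0.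
rewrite (_ : _ - _ = sw (fun a c => b a c - b' a c) x); last first.
  rewrite /sw -sumrB; apply: eq_bigr => k _; rewrite -sumrB; apply: eq_bigr => l _.
  by rewrite scalerBr.
apply: coideal_sw => // [v|u|a c cK].
- by apply: lin_add => //; apply: lin_opp.
- by apply: lin_add => //; apply: lin_opp.
- by rewrite bb' // subrr memv0.
Qed.

(** Let z be in the radical of the form on K, which is a left coideal by
    [regchar_strong_inv].  Hence u = f(z_1) z_2 lies in it too, and chi
    vanishes on all powers of u, which is therefore nilpotent.  But eps(u) = f(z), so f(z) = 0 for
    every coordinate f. *)
Lemma regchar_nondeg_coideal z : z \in K ->
  (forall x, x \in K -> chi (x * z) = 0) -> z = 0.
Proof.
move=> zK z0; rewrite [z](coord_vbasis (memvf z)) big1 // => i _.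
pose f := coord (vbasis {:H}) i : H -> F.
have lf : linF f by exact: lin_linear.
apply/eqP; rewrite scaler_eq0; apply/orP; left; rewrite -/(f z).
pose u := sw (fun a c => f a *: c) z.
have uK : u \in K.
  by apply: coideal_sw => //; [lint | lint | move=> a c cK; exact: rpredZ].
have chiu x : x \in K -> chi (x * u) = 0.
  move=> xK; have lx : linF (fun w => chi (x * w)) by apply: (lin_comp lchi); lint.
  rewrite /u (@sw_lin F H H F^o (fun w => chi (x * w))) //.
  transitivity (f (sw (fun a c => chi (x * c) *: a) z)).
    rewrite (@sw_lin F H H F^o f) //; apply: (@eq_sw F H F^o) => a c.
    by rewrite (linZ lx) (linZ lf) -![_ *: _]/(_ * _) mulrC.
  rewrite regchar_strong_inv (@eq_coideal_sw H _ (fun _ _ => 0)) //.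
  - by rewrite /sw big1 ?(lin0 lf) // => k _; rewrite big1 // => l _; rewrite scaler0.
  - by lint.
  - by lint.
  - by move=> v k s w; rewrite scaler0 addr0.
  - by move=> v k s w; rewrite scaler0 addr0.
  - by move=> a c cK; rewrite z0 // scale0r.
have uXK n : u ^+ n \in K.
  elim: n => [|n IHn]; first exact: coideal_unit.
  by rewrite exprS; apply: coidealM.
have [n un0] : exists n, u ^+ n = 0.
  by apply: trace0_nilpotent => k; rewrite exprSr; apply: chiu.
have <- : eps u = f z.
  rewrite /u (@sw_lin F H H F^o eps) // -[RHS](@sw_eps_r F H F^o f) //.
  apply: (@eq_sw F H F^o) => a c.
  by rewrite (linZ leps) -![_ *: _]/(_ * _) mulrC.
have epsX k : eps (u ^+ k) = eps u ^+ k.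
  by elim: k => [|k IHk]; rewrite ?counit1 // !exprS counitM IHk.
have := epsX n; rewrite un0 linear0 => /esym/eqP.
by rewrite expf_eq0 => /andP[].
Qed.

Lemma coideal_riesz (f : H -> F) : linF f ->
  exists2 z, z \in K & forall x, x \in K -> f x = chi (x * z).
Proof. exact: (regchar_riesz regchar_nondeg_coideal). Qed.

(** The element t of K dual to eps satisfies k t = eps(k) t = t k.  Its counit
    is nonzero: otherwise t has square 0, whereas chi(t) = eps(1) = 1. *)
Lemma coideal_integral : exists L : H,
  [/\ L \in K, forall k, k \in K -> k * L = eps k *: L,
      forall k, k \in K -> L * k = eps k *: L, eps L = 1 & chi L != 0].
Proof.
have [t tK tE] := coideal_riesz leps.
have uniq u v : u \in K -> v \in K ->
    (forall y, y \in K -> chi (y * u) = chi (y * v)) -> u = v.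
  move=> uK vK uv; apply/subr0_eq/regchar_nondeg_coideal; first exact: rpredB.
  move=> y yK; rewrite mulrBr -scaleN1r addrC lchi uv //.
  by rewrite scaleN1r addNr.
have lt k : k \in K -> k * t = eps k *: t.
  move=> kK; apply: uniq => [||y yK]; [exact: coidealM | exact: rpredZ |].
  rewrite mulrA -tE ?coidealM // counitM -scalerAr (linZ lchi) -tE //.
  by rewrite mulrC.
have rt k : k \in K -> t * k = eps k *: t.
  move=> kK; apply: uniq => [||y yK]; [exact: coidealM | exact: rpredZ |].
  rewrite mulrA regcharC mulrA -tE ?coidealM // counitM -scalerAr (linZ lchi) -tE //.
have chit : chi t = 1 by rewrite -[t]mul1r -tE ?counit1 // coideal_unit.
have et : eps t != 0.
  apply/eqP => et0; have := regchar_sq0 (z := t); rewrite lt // et0 scale0r chit.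
  by move/(_ erefl)/eqP; rewrite oner_eq0.
exists ((eps t)^-1 *: t); split.
- exact: rpredZ.
- by move=> k kK; rewrite -scalerAr lt // !scalerA mulrC.
- by move=> k kK; rewrite -scalerAl rt // !scalerA mulrC.
- by rewrite linearZ /= mulVf.
- by rewrite (linZ lchi) chit -[_ *: _]/(_ * _) mulr1 invr_eq0.
Qed.

End OneSubalgebra.

(** This equation recovers S(K) from L, as the range of f -> L_1 f(L_2). *)
Lemma coideal_integral_leg (K : {vspace H}) L y : left_coideal_subalgebra K ->
    (forall k, k \in K -> k * L = eps k *: L) -> y \in K ->
  sw (fun a c => chi (y * c) *: a) L = chi L *: S y.
Proof.
move=> KK LK yK; rewrite regchar_strong_inv.
rewrite (@eq_coideal_sw K KK H _ (fun a c => eps c *: (chi L *: S a))) //; try lint.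
  by rewrite (@sw_eps_r F H H (fun a => chi L *: S a)) //; lint.
by move=> a c cK; rewrite LK // (linZ lchi) scalerA.
Qed.

Lemma coideal_integral_sub (K K' : {vspace H}) L :
    left_coideal_subalgebra K -> left_coideal_subalgebra K' ->
    L \in K' -> (forall k, k \in K -> k * L = eps k *: L) ->
    (forall k, k \in K' -> k * L = eps k *: L) -> chi L != 0 ->
  (K <= K')%VS.
Proof.
move=> KK KK' LK' LK LK'' nL; apply/subvP => y yK.
have lf : linF (fun k => chi (y * k)) by apply: (lin_comp lchi); lint.
have [y' y'K' yy'] := coideal_riesz KK' lf.
suff -> : y = y' by [].
rewrite -[y]antipode_involutive -[y']antipode_involutive; congr (S _); apply: (scalerI nL).
rewrite -(coideal_integral_leg KK LK yK) -(coideal_integral_leg KK' LK'' y'K').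
apply: (eq_coideal_sw KK') => //; try by lint.
by move=> a c cK'; rewrite yy' // regcharC.
Qed.

(** The quadric x_1 (x) x_2 x = x (x) x, polarized. *)
Definition biproj_form (x y : H) : tensor H H :=
  sw (fun a c => tens a (c * y)) x - tens x y.

Lemma biproj_form_integral (K : {vspace H}) L : left_coideal_subalgebra K ->
    L \in K -> (forall k, k \in K -> k * L = eps k *: L) ->
  biproj_form L L = 0.
Proof.
move=> KK LK kL; apply/eqP; rewrite subr_eq0; apply/eqP.
rewrite (@eq_coideal_sw K KK _ _ (fun a c => eps c *: tens a L)) //; try lint.
  by rewrite (@sw_eps_r F H _ (fun a => tens a L)) //; lint.
by move=> a c cK; rewrite kL // (linZ (lin_tensr _ (@lin_id _ _))).
Qed.

(** Pair the second factor of the hypothesis with chi(y -).  For y = L the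
    terms that involve v only through chi(L v) cancel, which evaluates
    v_1 chi(L v_2) as chi(L) v.  For y = 1 this leaves L_1 chi(L_2 v) = chi(v) L,
    and [regchar_strong_inv] turns the two facts into chi(L) v = chi(v) S(L).
    Taking counits gives chi(v) = 0. *)
Lemma biproj_form_nondeg (K : {vspace H}) L v : left_coideal_subalgebra K ->
    L \in K -> (forall k, k \in K -> k * L = eps k *: L) ->
    (forall k, k \in K -> L * k = eps k *: L) -> eps L = 1 -> chi L != 0 ->
    eps v = 0 -> biproj_form v L + biproj_form L v = 0 ->
  v = 0.
Proof.
move=> KK LK kL Lk epsL nL epsv E.
have key y : y \in K ->
    eps y *: sw (fun a c => chi (L * c) *: a) v +
      sw (fun a c => chi (y * (c * v)) *: a) L
    = chi (y * L) *: v + chi (y * v) *: L.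
  move=> yK; pose P := mlift (fun a c => chi (y * c) *: a) : tensor H H -> H.
  have lP : lin P by exact: lin_mlift.
  have PE a c : P (tens a c) = chi (y * c) *: a by rewrite /P mlift_tens //; lint.
  have : P (sw (fun a c => tens a (c * L)) v + sw (fun a c => tens a (c * v)) L)
       = P (tens v L + tens L v).
    congr P; apply/eqP; rewrite -subr_eq0 opprD addrACA; exact/eqP.
  rewrite !(linD lP) !PE !(sw_lin _ _ lP) => <-.
  congr (_ + _); last by apply: eq_sw => a c; rewrite PE.
  rewrite (@sw_lin F H H H (fun z => eps y *: z)); last by lint.
  apply: eq_sw => a c; rewrite PE scalerA; congr (_ *: _).
  by symmetry; rewrite mulrA regcharC mulrA (Lk y yK) -scalerAl (linZ lchi).
have k1 := key 1 (coideal_unit KK).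
have kL1 := key L LK.
rewrite counit1 scale1r mul1r in k1.
rewrite epsL scale1r kL // epsL scale1r in kL1.
have E1 : sw (fun a c => chi (L * (c * v)) *: a) L = chi (L * v) *: L.
  rewrite (@eq_coideal_sw K KK H _ (fun a c => eps c *: (chi (L * v) *: a))) //; try lint.
    by rewrite (@sw_eps_r F H H (fun a => chi (L * v) *: a)) //; lint.
  by move=> a c cK; rewrite mulrA Lk // -scalerAl (linZ lchi) scalerA.
rewrite E1 in kL1; move/addIr: kL1 => X1.
have E2 : sw (fun a c => chi (c * v) *: a) L = chi v *: L.
  move: k1; rewrite X1 mul1r => /addrI <-.
  by apply: eq_sw => a c; rewrite mul1r.
have E3 : chi L *: v = chi v *: S L.
  rewrite -X1 regchar_strong_inv -linearZ -E2 /= (@sw_lin F H H H S) //; last by lint.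
  by apply: eq_sw => a c; rewrite linearZ.
have v0 : chi v = 0.
  have := congr1 eps E3; rewrite !linearZ /= epsv counit_antipode epsL mulr0 mulr1.
  by move=> <-.
by move: E3; rewrite v0 scale0r => /eqP; rewrite scaler_eq0 (negPf nL) => /eqP.
Qed.

End CoidealSubalgebra.

(** * Nondegenerate common zeros of quadrics *)

Section Congruence.
Variables (F : fieldType) (d : {poly F}).

Lemma det_congr m (A B : 'M[{poly F}]_m) :
  (forall i j, d %| A i j - B i j) -> d %| \det A - \det B.
Proof.
move=> AB; rewrite /determinant.
apply: (big_ind2 (fun x y : {poly F} => d %| x - y)); first by rewrite subrr dvdp0.
  by move=> x1 y1 x2 y2 h1 h2; rewrite opprD addrACA dvdp_add.
move=> s _; rewrite -mulrBr dvdp_mull //.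
apply: (big_ind2 (fun x y : {poly F} => d %| x - y)); first by rewrite subrr dvdp0.
  move=> x1 y1 x2 y2 h1 h2.
  rewrite (_ : _ - _ = (x1 - y1) * x2 + y1 * (x2 - y2)); last by ring.
  by apply: dvdp_add; [exact: dvdp_mulr | exact: dvdp_mull].
by move=> i _; exact: AB.
Qed.

(** Over the fraction field, the product has rank at most s. *)
Lemma det_low_rank (R : idomainType) m s (A : 'M[R]_(m, s)) (B : 'M[R]_(s, m)) :
  (s < m)%N -> \det (A *m B) = 0.
Proof.
move=> sm; apply/eqP; rewrite -tofrac_eq0 -det_map_mx map_mxM.
apply: contraTT sm; rewrite -leqNgt -unitfE -unitmxE -row_free_unit -row_leq_rank => mr.
by apply: leq_trans mr _; apply: leq_trans (mulmx_max_rank _ _) _.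
Qed.

End Congruence.

Section Generic.
Variables (F : closedFieldType) (n M : nat).

(** If C works for s and D for J, then det(K (C + u (D - C))) is a nonzero
    polynomial in u for each K in J :: s: look at u = 0, respectively u = 1. *)
Lemma generic_combination (s : seq 'M[F]_(n, M)) : all (fun J => row_free J) s ->
  exists C : 'M[F]_(M, n), all (fun J => J *m C \in unitmx) s.
Proof.
elim: s => [|J s IHs] /=; first by exists 0.
case/andP=> /row_freeP[D JD] /IHs[C sC].
pose Q (K : 'M[F]_(n, M)) : {poly F} :=
  \det (map_mx polyC (K *m C) + 'X *: map_mx polyC (K *m (D - C))).
have QE K u : (Q K).[u] = \det (K *m (C + u *: (D - C))).
  rewrite -horner_evalE -det_map_mx; congr (\det _); apply/matrixP => i j.
  rewrite [in RHS]mulmxDr -[in RHS]scalemxAr !mxE.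
  by rewrite -[LHS]/((_ + _).[u]) !hornerE.
have Qn : \prod_(K <- J :: s) Q K != 0.
  rewrite prodf_seq_neq0; apply/allP => K; rewrite inE => /predU1P[->|Ks] /=.
    apply: contraTneq isT => Q0; have := QE J 1.
    by rewrite Q0 horner0 scale1r addrC subrK JD det1 => /esym/eqP; rewrite oner_eq0.
  apply: contraTneq (allP sC _ Ks) => Q0; have := QE K 0.
  by rewrite Q0 horner0 scale0r addr0 unitmxE unitfE => <-; rewrite eqxx.
have /closed_nonrootP[u] := Qn; rewrite rootE horner_prod prodf_seq_neq0 => /allP nu.
exists (C + u *: (D - C)); rewrite -/(all _ (J :: s)); apply/allP => K /nu /=.
by rewrite QE unitmxE unitfE.
Qed.

End Generic.

Section NewtonLift.
Variables (F : fieldType) (n : nat).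
Variable f : 'I_n -> 'I_n.+1 -> 'I_n.+1 -> F.
Variable p : 'I_n.+1 -> F.
Hypothesis p0 : p ord0 = 1.
Hypothesis fp : forall c, \sum_a \sum_b f c a b * (p a * p b) = 0.
Hypothesis fsurj : forall r : 'I_n -> F, exists2 w : 'I_n.+1 -> F, w ord0 = 0 &
  forall c, \sum_a \sum_b f c a b * (p a * w b + w a * p b) = r c.

(** The equation t x_c^2 + f_c(x) = 0, where t is the polynomial variable and
    the coordinate ord0 is the homogenizing one. *)
Definition perturbed (P : 'I_n.+1 -> {poly F}) c : {poly F} :=
  'X * P (lift ord0 c) ^+ 2 + \sum_a \sum_b (f c a b)%:P * (P a * P b).

(** Newton's method: solving for the coefficient of t^(k+1) is a linear
    problem for the Jacobian at p, because the term t x_c^2 does not contribute to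
    the Jacobian at t = 0. *)
Lemma newton_lift k : exists P : 'I_n.+1 -> {poly F},
  [/\ P ord0 = 1, forall a, (P a).[0] = p a &
      forall c, 'X^(k.+1) %| perturbed P c].
Proof.
elim: k => [|k [P [P0 Pp PX]]].
  exists (fun a => (p a)%:P); split=> [|a|c]; rewrite ?p0 ?hornerC //.
  rewrite expr1 dvdp_add ?dvdp_mulr //.
  rewrite (_ : \sum_a _ = 0) ?dvdp0 // -[RHS](polyC0 F) -(fp c) rmorph_sum.
  apply: eq_bigr => a _; rewrite rmorph_sum; apply: eq_bigr => b _.
  by rewrite !rmorphM.
have /choice[R RE] : forall c, exists R, perturbed P c = R * 'X^(k.+1).
  by move=> c; have /dvdpP[R] := PX c; exists R.
have [w w0 wE] := fsurj (fun c => - (R c).[0]).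
pose P' a := P a + 'X^(k.+1) * (w a)%:P.
exists P'; split=> [|a|c].
- by rewrite /P' w0 mulr0 addr0.
- by rewrite /P' !hornerE Pp exprS mul0r mul0r addr0.
pose l := lift ord0 c.
pose Z := R c + ('X * (2%:R * P l * (w l)%:P) + 'X * ('X^(k.+1) * (w l)%:P ^+ 2)
  + \sum_a \sum_b (f c a b)%:P * (P a * (w b)%:P + (w a)%:P * P b)
  + 'X^(k.+1) * \sum_a \sum_b (f c a b)%:P * ((w a)%:P * (w b)%:P)).
have -> : perturbed P' c = Z * 'X^(k.+1).
  rewrite /Z mulrDl -RE /perturbed -/l.
  have -> : \sum_a \sum_b (f c a b)%:P * (P' a * P' b) =
     \sum_a \sum_b (f c a b)%:P * (P a * P b) +
     (\sum_a \sum_b (f c a b)%:P * (P a * (w b)%:P + (w a)%:P * P b)) * 'X^(k.+1) +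
     (\sum_a \sum_b (f c a b)%:P * ((w a)%:P * (w b)%:P)) * 'X^(k.+1) * 'X^(k.+1).
    rewrite !mulr_suml -!big_split; apply: eq_bigr => a _ /=.
    rewrite !mulr_suml -!big_split; apply: eq_bigr => b _ /=.
    by rewrite /P'; ring.
  by rewrite /P'; ring.
rewrite [X in X %| _]exprS dvdp_mul //.
have -> : 'X = 'X - (0 : F)%:P by rewrite polyC0 subr0.
rewrite dvdp_XsubCl rootE /Z !hornerD !hornerM hornerX hornerXn expr0n /= !mul0r !addr0.
rewrite addrC addr_eq0 -wE horner_sum add0r; apply/eqP.
apply: eq_bigr => a _; rewrite horner_sum; apply: eq_bigr => b _.
by rewrite !hornerE !Pp.
Qed.

End NewtonLift.

Section WordCount.
Variables (F : fieldType) (n m : nat).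
Variable f : 'I_n -> 'I_n.+1 -> 'I_n.+1 -> F.
Local Notation word := {ffun 'I_m -> 'I_n.+1}.

(** Words in the homogeneous coordinates stand for monomials of degree at most
    m; repeated letters make replacing two positions a matter of [word_upd]. *)
Definition word_mon (P : 'I_n.+1 -> {poly F}) (w : word) : {poly F} := \prod_i P (w i).

Definition repetition (w : word) : option ('I_m * 'I_m * 'I_n) :=
  [pick x : 'I_m * 'I_m * 'I_n |
     [&& x.1.1 != x.1.2, w x.1.1 == lift ord0 x.2 & w x.1.2 == lift ord0 x.2]].

Definition word_upd (w : word) i j a b : word :=
  [ffun k => if k == i then a else if k == j then b else w k].

Definition letters (w : word) : {set 'I_n} := [set c | lift ord0 c \in codom w].

(** The squarefree monomials. *)
Definition setmon (P : 'I_n.+1 -> {poly F}) (s : {set 'I_n}) : {poly F} :=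
  \prod_c P (lift ord0 c) ^+ (c \in s).

(** The matrix A that expresses t times a monomial with a repeated variable by
    means of t x_c^2 = - f_c(x). *)
Definition word_coef (w w' : word) : F :=
  if repetition w is Some (i, j, c) then
    - \sum_a \sum_b f c a b * (word_upd w i j a b == w')%:R
  else 0.

Lemma word_mon_norepet P w : P ord0 = 1 -> repetition w = None -> word_mon P w = setmon P (letters w).
Proof.
rewrite /repetition; case: pickP => // nr P0 _.
rewrite /word_mon (partition_big w xpredT) //= big_ord_recl big1 ?mul1r => [|i /eqP -> //].
apply: eq_bigr => c _.
rewrite (eq_bigr (fun=> P (lift ord0 c))) => [|i /eqP -> //].
rewrite prodr_const; congr (_ ^+ _).
rewrite inE; case: (boolP (lift ord0 c \in codom w)) => [/codomP[i wi]|nc] /=.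
  suff /fintype.eq_card1 -> : [pred j | w j == lift ord0 c] =i pred1 i by [].
  move=> j; rewrite !inE wi; apply/eqP/eqP => [wj|-> //].
  apply/eqP; apply: contraT => nji; have := nr (j, i, c).
  by rewrite /= nji wj -wi eqxx.
suff /fintype.eq_card0 -> : [pred j | w j == lift ord0 c] =i pred0 by [].
move=> j; rewrite !inE; apply: contraNF nc => /eqP <-; exact: codom_f.
Qed.

Lemma word_mon_repet P w i j c : repetition w = Some (i, j, c) ->
  exists g, word_mon P w = P (lift ord0 c) ^+ 2 * g /\
    forall a b, word_mon P (word_upd w i j a b) = P a * P b * g.
Proof.
rewrite /repetition; case: pickP => // -[[i' j'] c'] /= /and3P[nij /eqP wi /eqP wj] [<- <- <-].
exists (\prod_(k | (k != i') && (k != j')) P (w k)); split=> [|a b].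
  rewrite /word_mon (bigD1 i') //= (bigD1 j') /=; last by rewrite eq_sym.
  by rewrite wi wj mulrA.
rewrite /word_mon (bigD1 i') //= (bigD1 j') /=; last by rewrite eq_sym.
rewrite !ffunE eqxx eq_sym (negPf nij) eqxx mulrA; congr (_ * _).
by apply: eq_bigr => k /andP[ki kj]; rewrite ffunE (negPf ki) (negPf kj).
Qed.

Lemma word_mon_relation P K w : P ord0 = 1 ->
    (forall c, 'X^K %| perturbed f P c) ->
  'X^K %| 'X * word_mon P w - \sum_w' (word_coef w w')%:P * word_mon P w'
          - (if repetition w is Some _ then 0 else 'X * setmon P (letters w)).
Proof.
move=> P0 PX; rewrite /word_coef; case rw: (repetition w) => [[[i j] c]|]; last first.
  rewrite [X in _ - X - _]big1 => [|w' _]; last by rewrite mul0r.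
  by rewrite subr0 (word_mon_norepet P0 rw) subrr dvdp0.
have [g [wE uE]] := word_mon_repet P rw.
rewrite subr0 wE (_ : \sum_w' _ = - (\sum_a \sum_b (f c a b)%:P * (P a * P b)) * g).
  rewrite mulNr opprK mulrA -mulrDl; apply: dvdp_mulr; exact: PX.
rewrite mulNr mulr_suml -sumrN.
transitivity (\sum_w' \sum_a \sum_b
    - ((f c a b)%:P * (word_upd w i j a b == w')%:R * word_mon P w')).
  apply: eq_bigr => w' _; rewrite polyCN mulNr rmorph_sum mulr_suml -sumrN.
  apply: eq_bigr => a _; rewrite rmorph_sum mulr_suml -sumrN; apply: eq_bigr => b _.
  by rewrite rmorphM rmorph_nat.
rewrite exchange_big; apply: eq_bigr => a _; rewrite exchange_big mulr_suml -sumrN.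
apply: eq_bigr => b _; rewrite (bigD1 (word_upd w i j a b)) //= big1 ?addr0 => [|w' nw].
  by rewrite eqxx mulr1 uE mulrA.
by rewrite eq_sym (negPf nw) mulr0 mul0r oppr0.
Qed.

End WordCount.

Section QuadricPoints.
Variables (F : closedFieldType) (n M m : nat).
Variable B : 'I_M -> 'I_n.+1 -> 'I_n.+1 -> F.
Variable p : 'I_m -> 'I_n.+1 -> F.
Hypothesis p0 : forall j, p j ord0 = 1.
Hypothesis p_inj : forall j l, j != l -> exists a, p j a != p l a.
Hypothesis Bp : forall j k, \sum_a \sum_b B k a b * (p j a * p j b) = 0.

Definition polar (Q : 'I_n.+1 -> 'I_n.+1 -> F) (x w : 'I_n.+1 -> F) : F :=
  \sum_a \sum_b Q a b * (x a * w b + w a * x b).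

Hypothesis B_nondeg : forall j w, w ord0 = 0 ->
  (forall k, polar (B k) (p j) w = 0) -> forall a, w a = 0.

(** The tangent vector of the hyperplane ord0 = 1 with components v. *)
Definition affdir (v : 'I_n -> F) (a : 'I_n.+1) : F :=
  \sum_c v c * (a == lift ord0 c)%:R.

Lemma affdir0 v : affdir v ord0 = 0.
Proof. by rewrite /affdir big1 // => c _; rewrite mulr0. Qed.

Lemma affdir_lift v c : affdir v (lift ord0 c) = v c.
Proof.
rewrite /affdir (bigD1 c) //= eqxx mulr1 big1 ?addr0 // => d nd.
by rewrite (inj_eq lift_inj) eq_sym (negPf nd) mulr0.
Qed.

Lemma polar_affdir Q x v :
  polar Q x (affdir v) = \sum_c v c * polar Q x (fun a => (a == lift ord0 c)%:R).
Proof.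
rewrite /polar; under [RHS]eq_bigr => c _ do rewrite mulr_sumr.
rewrite [RHS]exchange_big; apply: eq_bigr => a _ /=.
under [RHS]eq_bigr => c _ do rewrite mulr_sumr.
rewrite [RHS]exchange_big; apply: eq_bigr => b _ /=.
rewrite /affdir mulr_sumr mulr_suml -big_split mulr_sumr; apply: eq_bigr => c _ /=.
by ring.
Qed.

(** n generic linear combinations of the equations still have an invertible
    Jacobian at each of the finitely many points. *)
Lemma square_subsystem : exists f : 'I_n -> 'I_n.+1 -> 'I_n.+1 -> F,
  (forall j c, \sum_a \sum_b f c a b * (p j a * p j b) = 0) /\
  (forall j (r : 'I_n -> F), exists2 w : 'I_n.+1 -> F, w ord0 = 0 &
     forall c, polar (f c) (p j) w = r c).
Proof.
pose J j : 'M[F]_(n, M) :=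
  \matrix_(c, k) polar (B k) (p j) (fun a => (a == lift ord0 c)%:R).
have Jfree : all (fun J => row_free J) [seq J j | j <- enum 'I_m].
  apply/allP => _ /mapP[j _ ->]; rewrite -kermx_eq0; apply/rowV0P => v /sub_kermxP vJ.
  apply/rowP => c; rewrite mxE -(affdir_lift (v 0)); apply: B_nondeg (affdir0 _) _ _ => k.
  rewrite polar_affdir; have /rowP/(_ k) := vJ; rewrite [RHS]mxE mxE => vJk.
  by apply: etrans vJk; apply: eq_bigr => d _; rewrite mxE.
have [C /allP CJ] := generic_combination Jfree.
pose f c a b := \sum_k B k a b * C k c.
have fE (g : 'I_n.+1 -> 'I_n.+1 -> F) c :
    \sum_a \sum_b f c a b * g a b = \sum_k (\sum_a \sum_b B k a b * g a b) * C k c.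
  under [RHS]eq_bigr => k _ do rewrite mulr_suml.
  rewrite [RHS]exchange_big; apply: eq_bigr => a _ /=.
  under [RHS]eq_bigr => k _ do rewrite mulr_suml.
  rewrite [RHS]exchange_big; apply: eq_bigr => b _ /=.
  by rewrite /f mulr_suml; apply: eq_bigr => k _; rewrite mulrAC.
exists f; split=> [j c|j r].
  by rewrite fE big1 // => k _; rewrite Bp mul0r.
have uJ : J j *m C \in unitmx by apply: CJ; rewrite map_f ?mem_enum.
pose v := (\row_c r c) *m invmx (J j *m C).
exists (affdir (v 0)); first exact: affdir0.
move=> c; transitivity ((v *m (J j *m C)) 0 c); last by rewrite mulmxKV // mxE.
rewrite mulmxA mxE /polar fE; apply: eq_bigr => k _; congr (_ * _).
rewrite -/(polar (B k) (p j) (affdir (v 0))) polar_affdir [RHS]mxE.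
by apply: eq_bigr => d _; rewrite [J j _ _]mxE.
Qed.

(** The products over l of the forms lam j l take the values 0 and 1 of the
    Lagrange interpolation at the points p. *)
Lemma separating_forms : exists lam : 'I_m -> 'I_m -> 'I_n.+1 -> F,
  (forall j l, \sum_b lam j l b * p j b = 1) /\
  (forall j l, j != l -> \sum_b lam j l b * p l b = 0).
Proof.
suff /choice[lam lamP] : forall jl : 'I_m * 'I_m, exists la : 'I_n.+1 -> F,
    \sum_b la b * p jl.1 b = 1 /\ (jl.1 != jl.2 -> \sum_b la b * p jl.2 b = 0).
  by exists (fun j l => lam (j, l)); split=> j l; have [] := lamP (j, l).
have ev (k k' : F) (a : 'I_n.+1) x : x ord0 = 1 ->
    \sum_b (k * (b == a)%:R + k' * (b == ord0)%:R) * x b = k * x a + k'.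
  move=> x0; under eq_bigr => b _ do rewrite mulrDl.
  rewrite big_split /= (bigD1 a) //= big1 => [|b nb]; last by rewrite (negPf nb) mulr0 mul0r.
  rewrite (bigD1 ord0) //= big1 => [|b nb]; last by rewrite (negPf nb) mulr0 mul0r.
  by rewrite !eqxx x0 !mulr1 !addr0.
move=> [j l] /=; have [->|/p_inj[a na]] := eqVneq j l.
  exists (fun b => 0 * (b == ord0)%:R + 1 * (b == ord0)%:R); split=> //.
  by rewrite ev // mul0r add0r.
have d0 : p j a - p l a != 0 by rewrite subr_eq0.
exists (fun b => (p j a - p l a)^-1 * (b == a)%:R
   + (- (p j a - p l a)^-1 * p l a) * (b == ord0)%:R).
by split=> [|_]; rewrite ev //; field.
Qed.

(** Let E and ES hold the values at the lifted points of the words and of the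
    squarefree monomials.  Modulo a high power of t, char_poly A *: (L *m E)
    factors through ES, which has 2 ^ n rows, so its determinant vanishes if
    2 ^ n < m.  But det(L *m E) has constant term 1 for the Lagrange coefficients
    L, and char_poly A does not depend on the precision of the lift. *)
Theorem nondegenerate_quadric_points : (m <= 2 ^ n)%N.
Proof.
rewrite leqNgt; apply/negP => lt_m.
have [f [fp fsurj]] := square_subsystem.
have [lam [lam1 lam0]] := separating_forms.
pose word := {ffun 'I_m -> 'I_n.+1}.
pose q := #|{: word}|; pose s := #|{: {set 'I_n}}|.
pose A : 'M[F]_q := \matrix_(x, y) word_coef f (enum_val x : word) (enum_val y : word).
(* A precision beyond the degree of det(t - A) ^+ m. *)
pose K := (size (char_poly A ^+ m)).+1.
have /choice[P PP] : forall j, exists P : 'I_n.+1 -> {poly F},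
    [/\ P ord0 = 1, forall a, (P a).[0] = p j a & forall c, 'X^K %| perturbed f P c].
  by move=> j; apply: newton_lift => //; exact: fsurj.
have P0 j : P j ord0 = 1 by case: (PP j).
have Pp j a : (P j a).[0] = p j a by case: (PP j).
have PX j c : 'X^K %| perturbed f (P j) c by case: (PP j).
pose E : 'M[{poly F}]_(q, m) := \matrix_(x, j) word_mon (P j) (enum_val x).
pose Bm : 'M[{poly F}]_(q, s) := \matrix_(x, y)
  if repetition (enum_val x : word) is Some _ then 0
  else 'X * (letters (enum_val x : word) == enum_val y)%:R.
pose ES : 'M[{poly F}]_(s, m) := \matrix_(y, j) setmon (P j) (enum_val y).
have sum_enum (T : finType) (g : T -> {poly F}) :
    \sum_(x < #|{: T}|) g (enum_val x) = \sum_w g w.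
  by rewrite -(big_enum_val (A := T) g); apply: eq_bigl => x; rewrite inE.
have /choice[Z ZE] : forall xj : 'I_q * 'I_m, exists z,
    (char_poly_mx A *m E - Bm *m ES) xj.1 xj.2 = 'X^K * z.
  move=> [x j] /=; set w : word := enum_val x.
  have /dvdpP[z zE] := word_mon_relation w (P0 j) (PX j).
  exists z; rewrite mulrC -zE !mxE; congr (_ - _).
    under eq_bigr => y _ do rewrite !mxE mulrBl.
    rewrite sumrB; congr (_ - _).
      rewrite (bigD1 x) //= big1 ?addr0 => [|y ny]; first by rewrite eqxx mulr1n.
      by rewrite eq_sym (negPf ny) mulr0n mul0r.
    rewrite -(sum_enum _ (fun w' => (word_coef f w w')%:P * word_mon (P j) w')).
    by apply: eq_bigr => y _.
  under eq_bigr => y _ do rewrite !mxE.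
  rewrite -/w; case: (repetition w) => [_|]; first by rewrite big1 // => y _; rewrite mul0r.
  rewrite (sum_enum _ (fun t => 'X * (letters w == t)%:R * setmon (P j) t)).
  rewrite (bigD1 (letters w)) //= eqxx mulr1 big1 ?addr0 // => t nt.
  by rewrite eq_sym (negPf nt) mulr0 mul0r.
pose Zm : 'M[{poly F}]_(q, m) := \matrix_(x, j) Z (x, j).
have rel : char_poly_mx A *m E = Bm *m ES + 'X^K *: Zm.
  apply/matrixP => x j; move: (ZE (x, j)).
  rewrite /= mxE [X in _ + X]mxE => /eqP; rewrite subr_eq addrC => /eqP ->.
  by rewrite [RHS]mxE; congr (_ + _); rewrite mxE [Zm _ _]mxE.
pose L : 'M[{poly F}]_(m, q) :=
  \matrix_(j, x) (\prod_l lam j l ((enum_val x : word) l))%:P.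
pose adj := \adj (char_poly_mx A).
have GE : char_poly A *: (L *m E) = (L *m adj *m Bm) *m ES + 'X^K *: (L *m adj *m Zm).
  rewrite -!mulmxA scalemxAr -mul_scalar_mx -mul_adj_mx -/adj.
  by rewrite -!mulmxA rel mulmxDr mulmxDr -!scalemxAr.
have detG : (\det (L *m E)).[0] = 1.
  rewrite -horner_evalE -det_map_mx -[RHS](det1 F m); congr (\det _).
  apply/matrixP => j j'; rewrite !mxE -[LHS]/((_ : {poly F}).[0]) horner_sum.
  transitivity (\sum_(w : word) \prod_l (lam j l (w l) * p j' (w l))).
    pose h (w : word) := \prod_l (lam j l (w l) * p j' (w l)).
    rewrite -[RHS](@hornerC _ (\sum_w h w) 0) rmorph_sum /= -(sum_enum _ (fun w => (h w)%:P)).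
    rewrite horner_sum; apply: eq_bigr => x _; rewrite !mxE hornerC hornerM hornerC.
    rewrite /word_mon horner_prod -big_split /=; apply: eq_bigr => l _.
    by rewrite Pp.
  rewrite -(bigA_distr_bigA (fun l b => lam j l b * p j' b)) /=.
  have [<-|njj'] := eqVneq j j'; first by rewrite big1 // => l _; rewrite lam1.
  by rewrite (bigD1 j') //= lam0 // mul0r.
have dv : 'X^K %| char_poly A ^+ m * \det (L *m E).
  rewrite -detZ -[X in _ %| X]subr0 -(det_low_rank (L *m adj *m Bm) ES); last first.
    by rewrite /s -cardsT -powersetT card_powerset cardsT card_ord.
  by apply: det_congr => i j; rewrite GE [X in X - _]mxE addrAC subrr add0r mxE dvdp_mulr.
have cX : coprimep 'X^K (\det (L *m E)).
  rewrite coprimep_expl // coprimep_sym -['X]subr0 -polyC0 coprimep_XsubC rootE detG.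
  exact: oner_neq0.
have nchi : char_poly A ^+ m != 0 by rewrite expf_neq0 // monic_neq0 // char_poly_monic.
have := dvdp_leq nchi (etrans (esym (Gauss_dvdpl _ cX)) dv).
by rewrite size_polyXn /K ltnNge leqnSn.
Qed.

End QuadricPoints.

(** * Counting left coideal subalgebras *)

(** A list of maximal length enumerates A; its positions give the injection. *)
Lemma card_le_uniq (T : eqType) (A : set T) k :
  (forall s : seq T, uniq s -> (forall x, x \in s -> A x) -> (size s <= k)%N) ->
  (A #<= `I_k)%card.
Proof.
move=> sk.
pose ok n := `[< exists s : seq T, [/\ uniq s, forall x, x \in s -> A x & size s = n] >].
have ok0 : exists n, ok n by exists 0%N; apply/asboolP; exists [::].
have okk n : ok n -> (n <= k)%N by move=> /asboolP[s [us sA <-]]; exact: sk.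
have [_ /asboolP[s [us sA <-]] smax] := ex_maxnP ok0 okk.
have As x : A x -> x \in s.
  move=> Ax; apply: contraT => xs; have : ok (size s).+1.
    apply/asboolP; exists (x :: s); split=> [|y|//]; first by rewrite /= xs us.
    by rewrite inE => /predU1P[->|/sA].
  by move/smax; rewrite ltnn.
apply/pcard_leP/injfunPex; exists (fun x => index x s).
  move=> x Ax /=; rewrite /mkset; apply: leq_trans (sk s us sA).
  by rewrite index_mem As.
move=> x y /set_mem Ax /set_mem Ay xy.
by rewrite -[x](nth_index x (As _ Ax)) xy nth_index // As.
Qed.

Section AugmentationBasis.
Variables (F : fieldType) (H : hopfType F).
Local Notation eps := (@counit F H).

Definition augm : {vspace H} := lker (linfun (eps : H -> F^o)).

Lemma in_augm x : (x \in augm) = (eps x == 0).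
Proof. by rewrite memv_ker lfunE. Qed.

Lemma dim_augm : (\dim augm).+1 = \dim {:H}.
Proof.
have := limg_ker_dim (linfun (eps : H -> F^o)) {:H}.
rewrite capfv -/augm => <-.
suff -> : \dim (linfun (eps : H -> F^o) @: {:H}) = 1%N by rewrite addn1.
apply/eqP; rewrite eqn_leq; apply/andP; split.
  by apply: leq_trans (dimvS (subvf _)) _; rewrite dimvf /dim /=.
rewrite lt0n dimv_eq0; apply: contraTneq (memv_img (linfun (eps : H -> F^o)) (memvf (1 : H))) => ->.
by rewrite memv0 lfunE /= counit1 oner_neq0.
Qed.

Local Notation n := (\dim augm).

Definition affine_basis (a : 'I_n.+1) : H :=
  if unlift ord0 a is Some c then (vbasis augm)`_c else 1.

Definition from_affine (w : 'I_n.+1 -> F) : H := \sum_a w a *: affine_basis a.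

(** Coordinates with respect to [affine_basis]; the one of index ord0 is the
    counit, so the hyperplane of counit 1 is the affine chart ord0 = 1. *)
Definition to_affine (x : H) (a : 'I_n.+1) : F :=
  if unlift ord0 a is Some c then coord (vbasis augm) c (x - eps x *: 1) else eps x.

Lemma from_affineE w :
  from_affine w = w ord0 *: 1 + \sum_(c < n) w (lift ord0 c) *: (vbasis augm)`_c.
Proof.
rewrite /from_affine big_ord_recl /affine_basis unlift_none; congr (_ + _).
by apply: eq_bigr => c _; rewrite liftK.
Qed.

Lemma to_affineK x : from_affine (to_affine x) = x.
Proof.
rewrite from_affineE /to_affine unlift_none.
under eq_bigr => c _ do rewrite liftK.
have xK : x - eps x *: 1 \in augm.
  by rewrite in_augm linearB linearZ /= counit1 mulr1 subrr.
by rewrite -(coord_vbasis xK) addrC subrK.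
Qed.

Lemma counit_from_affine w : eps (from_affine w) = w ord0.
Proof.
rewrite from_affineE linearD linearZ /= counit1 mulr1 linear_sum big1 ?addr0 //.
move=> c _; rewrite linearZ /= (_ : eps _ = 0) ?mulr0 //; apply/eqP.
by rewrite -in_augm vbasis_mem // mem_nth // size_tuple.
Qed.

Lemma from_affine_eq0 w : from_affine w = 0 -> forall a, w a = 0.
Proof.
move=> w0; have wo : w ord0 = 0 by rewrite -counit_from_affine w0 linear0.
move=> a; case: (unliftP ord0 a) => [c|] -> //.
move: w0; rewrite from_affineE wo scale0r add0r => /(congr1 (coord (vbasis augm) c)).
by rewrite linear0 (coord_sum_free (fun c => w (lift ord0 c))) // (basis_free (vbasisP _)).
Qed.

End AugmentationBasis.

Section Count.
Variables (F : numClosedFieldType) (H : hopfType F).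
Hypothesis ssH : semisimple H.
Local Notation eps := (@counit F H).
Local Notation n := (\dim (augm H)).

Lemma coideal_family_le (m : nat) (K : 'I_m -> {vspace H}) : injective K ->
  (forall j, left_coideal_subalgebra (K j)) -> (m <= 2 ^ n)%N.
Proof.
move=> Kinj KK.
have /choice[L LP] := fun j => coideal_integral ssH (KK j).
pose b a : H := affine_basis a.
pose B (k : 'I_(\dim {:H} * \dim {:H})) (a a' : 'I_n.+1) : F :=
  mxvec (biproj_form (b a) (b a') : 'M_(\dim {:H})) 0 k.
have lfl y : lin (fun x => @biproj_form F H x y).
  by rewrite /biproj_form; lint.
have lfr x : lin (@biproj_form F H x) by rewrite /biproj_form; lint.
have BE (x y : 'I_n.+1 -> F) k : \sum_a \sum_a' B k a a' * (x a * y a') =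
    mxvec (biproj_form (from_affine x) (from_affine y) : 'M_(\dim {:H})) 0 k.
  rewrite {1}/from_affine (lin_sum (lfl _)) linear_sum summxE; apply: eq_bigr => a _.
  rewrite (linZ (lfl _)) {1}/from_affine (lin_sum (lfr _)) scaler_sumr linear_sum summxE.
  apply: eq_bigr => a' _; rewrite (linZ (lfr _)) scalerA linearZ /= mxE mulrC.
  by [].
apply: (@nondegenerate_quadric_points F n _ m B (fun j => to_affine (L j))).
- by move=> j; case: (LP j) => _ _ _ e1 _; rewrite /to_affine unlift_none.
- move=> j l njl; apply: contrapT => /forallNP same.
  case/eqP: njl; apply: Kinj.
  have LL : L j = L l.
    rewrite -[L j]to_affineK -[L l]to_affineK; congr from_affine; apply/funext => a.
    by apply/eqP; have /negP := same a; rewrite negbK.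
  have [j1 j2 j3 j4 j5] := LP j; have [l1 l2 l3 l4 l5] := LP l.
  apply/eqP; rewrite eqEsubv; apply/andP; split.
    by apply: (coideal_integral_sub ssH (KK j) (KK l) (L := L j)) => //; rewrite LL.
  by apply: (coideal_integral_sub ssH (KK l) (KK j) (L := L j)) => //; rewrite LL.
- move=> j k; rewrite BE !to_affineK.
  have [j1 j2 _ _ _] := LP j.
  by rewrite (biproj_form_integral (KK j) j1 j2) linear0 mxE.
move=> j w w0 polar0; apply: from_affine_eq0.
have [j1 j2 j3 j4 j5] := LP j.
apply: (biproj_form_nondeg ssH (KK j) j1 j2 j3 j4 j5).
  by rewrite counit_from_affine.
apply: (can_inj (@mxvecK _ _ _)); rewrite linear0 addrC; apply/rowP => k; rewrite mxE.
rewrite linearD mxE -{1 2}[L j]to_affineK -!BE -[RHS](polar0 k) /polar -big_split.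
apply: eq_bigr => a _; rewrite -big_split; apply: eq_bigr => a' _ /=.
by rewrite mulrDr.
Qed.

End Count.

Unset Implicit Arguments.
Local Close Scope ring_scope.

Theorem corollary1p4 (R : realType) (H : hopfType (complex R)) (N : nat)
    (ssH : semisimple H) (dimH : \dim {:H} = N) :
  ([set K : {vspace H} | left_coideal_subalgebra K]%classic
     #<= `I_(2 ^ (N - 1))%classic)%card.
Proof.
apply: card_le_uniq => s us sK.
rewrite -dimH -dim_augm subn1 /=.
apply: (@coideal_family_le _ H ssH (size s) (tnth (in_tuple s))).
  by apply/tuple_uniqP.
by move=> j; apply: sK; exact: mem_tnth.
Qed.
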